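(* Let $I=[-T,T]$ and consider the problem $$Lu(t)=h(t),\ t\in I,\qquad B_iu=0,\ i=1,\dots,n, \qquad (\ast)$$ where $$L=\sum_{i}a_i\,\varphi^*D^i+\sum_{j}b_j\,D^j\in\mathbb{R}[D,\varphi^*]$$ (finite sums over $i,j\in\{0,1,\dots\}$ with real coefficients $a_i,b_j$), $h\in L^1(I)$ and $$B_iu:=\sum_{j=0}^{n-1}\left(\alpha_{ij}u^{(j)}(-T)+\beta_{ij}u^{(j)}(T)\right),\qquad i=1,\dots,n,$$ with real coefficients $\alpha_{ij},\beta_{ij}$. Then there exists $R\in\mathbb{R}[D,\varphi^*]$, of the form $$R=\sum_{k}a_k\,\varphi^*D^k+\sum_{l}(-1)^{l+1}b_l\,D^l,$$ such that $S:=RL\in\mathbb{R}[D]$, and the unique solution of problem $(\ast)$ is given by $$\int_{-T}^{T}R_\vdash G(t,s)\,h(s)\,\mathrm{d}s,$$ where $G$ is the Green's function associated to the problem $$Su=0,\qquad B_iRu=0,\quad B_iu=0,\quad i=1,\dots,n,$$ assuming that this last problem has a unique solution.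
   Context: $D$ is the differentiation operator and $(\varphi^*f)(t)=f(-t)$ is the pullback by the reflection $\varphi(t)=-t$. $\mathbb{R}[D,\varphi^*]$ is the real algebra, under composition, of finite real linear combinations of $D^k$ and $\varphi^*D^k$, $k\ge0$ ($D^0=\mathrm{Id}$), where $D^k\varphi^*=(-1)^k\varphi^*D^k$; $\mathbb{R}[D]$ is the ring of real polynomials in $D$. For an operator $\mathcal{L}$ acting on functions of one variable and a suitable function $G(t,s)$, $\mathcal{L}_\vdash G(t,s):=\mathcal{L}(G(\cdot,s))|_{t}$ for every $s$, i.e. $\mathcal{L}$ acts on the first variable with $s$ fixed. Green's function: for an operator $S=\sum_{k=0}^{N}c_kD^k$ with constant real coefficients and leading coefficient $c_N\ne 0$, and a collection of homogeneous linear boundary conditions at the endpoints of $I=[a,b]$, the Green's function associated to the problem consisting of $Su=0$ on $I$ and these boundary conditions is the function $G$ such that: (G1) $G$ is defined on $I^2$; (G2) the partial derivatives $\partial^kG/\partial t^k$ exist and are continuous on $I^2$ for $k=0,\dots,N-2$; (G3) $\partial^{N-1}G/\partial t^{N-1}$ and $\partial^{N}G/\partial t^{N}$ exist and are continuous on $I^2\setminus\{(t,t):t\in I\}$; (G4) for every $t\in(a,b)$ the lateral limits $\frac{\partial^{N-1}G}{\partial t^{N-1}}(t,t^{+})$ and $\frac{\partial^{N-1}G}{\partial t^{N-1}}(t,t^{-})$ exist and $\frac{\partial^{N-1}G}{\partial t^{N-1}}(t,t^-)-\frac{\partial^{N-1}G}{\partial t^{N-1}}(t,t^+)=\frac1{c_N}$;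 (G5) for each $s\in(a,b)$, $G(\cdot,s)$ is a solution of $Su=0$ on $I\setminus\{s\}$; (G6) for each $s\in(a,b)$, $G(\cdot,s)$ satisfies the boundary conditions. (When there are $N$ boundary conditions, each a linear combination of the values $u^{(j)}(a),u^{(j)}(b)$, $0\le j\le N-1$, and the homogeneous problem has a unique solution, it is known that such a $G$ exists and is unique.) In the theorem, $[a,b]=[-T,T]$ and the boundary conditions are $B_iRu=0$, $B_iu=0$, $i=1,\dots,n$.
   Formalization: For the solution formula, n ≥ 1 is taken to be the order of L and S = RL is assumed to have order exactly 2n (the number of boundary conditions); without this the formula can fail, e.g. L = φ*D² + D² + Id with periodic conditions. *)

(* Defs.v *)
From HB Require Import structures.
From mathcomp Require Import all_boot all_order all_algebra.
From mathcomp Require Import all_classical all_reals all_analysis.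
Set Implicit Arguments.
Unset Strict Implicit.
Unset Printing Implicit Defensive.
Import Order.TTheory GRing.Theory Num.Theory.
Import numFieldNormedType.Exports.
Local Open Scope classical_set_scope.
Local Open Scope ring_scope.

Section Derivatives.
Variable R : realType.
Implicit Types (I J : set R) (u v : R -> R) (c : {poly R}).

(* Functions on an interval [I] are represented by functions [R -> R] whose
   values outside [I] are irrelevant; derivatives are taken within [I], hence
   are one-sided at the endpoints of a closed interval. *)
Definition quot u (t : R) : R -> R := fun x => (u x - u t) / (x - t).

Definition derivable_in I u (t : R) : Prop :=
  cvg (quot u t x @[x --> within I t^']).

Definition deriv_in I u : R -> R :=
  fun t => lim (quot u t x @[x --> within I t^']).

(* D^k u; meaningless at the points where the derivative does not exist. *)
Definition derivn_in I (k : nat) u : R -> R := iter k (deriv_in I) u.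

(* [J] is meant to be a relatively open subset of [I]. *)
Definition nderivable I J (k : nat) u : Prop :=
  forall j, (j < k)%N -> forall t, J t -> derivable_in I (derivn_in I j u) t.

Definition smooth_on I u : Prop := forall k, nderivable I I k u.

(* The element [\sum_k c_k D^k] of R[D] is represented by the polynomial [c]. *)
Definition diffop I c u : R -> R :=
  fun t => \sum_(k < size c) c`_k * derivn_in I k u t.

(* The Sobolev space W^{1,1}(a, b), through continuous representatives. *)
Definition W11 (a b : R) v : Prop :=
  exists2 g : R -> R,
    (@lebesgue_measure R).-integrable `[a, b] (EFin \o g) &
    forall t, `[a, b]%classic t ->
      v t = v a + \int[@lebesgue_measure R]_(s in `[a, t]) g s.

(* W^{n,1}(a, b) for n >= 1. *)
Definition Wn1 (a b : R) (n : nat) u : Prop :=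
  nderivable `[a, b] `[a, b] n.-1 u /\ W11 a b (derivn_in `[a, b] n.-1 u).

Definition unique_solution_on I (P : (R -> R) -> Prop) u : Prop :=
  P u /\ forall v, P v -> forall t, I t -> v t = u t.

End Derivatives.

Section ReflectionOperators.
Variable R : realType.
Implicit Types (I : set R) (u : R -> R).

(* [ReflOp a b] is the element [\sum_i a_i phi^* D^i + \sum_j b_j D^j] of
   R[D, phi^*]. *)
Record reflop := ReflOp { refl_part : {poly R}; diff_part : {poly R} }.

Definition pullback u : R -> R := fun t => u (- t).

Definition apply_op I (P : reflop) u : R -> R :=
  fun t => pullback (diffop I (refl_part P) u) t + diffop I (diff_part P) u t.

Definition op_order (P : reflop) : nat :=
  (maxn (size (refl_part P)) (size (diff_part P))).-1.

(* [Q P = S] with [S] in R[D], the product being composition of operators;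
   on an interval symmetric about 0 this determines [S]. *)
Definition comp_is_diffop I (Q P : reflop) (S : {poly R}) : Prop :=
  forall u, smooth_on I u ->
    forall t, I t -> apply_op I Q (apply_op I P u) t = diffop I S u t.

Definition companion (P : reflop) : reflop :=
  ReflOp (refl_part P)
    (\poly_(l < size (diff_part P)) ((-1) ^+ l.+1 * (diff_part P)`_l)).

End ReflectionOperators.

Section Problems.
Variable R : realType.
Implicit Types (u h : R -> R) (G : R -> R -> R).

(* Conditions are indexed by 'I_n, i.e. by 0, ..., n - 1. *)
Definition bform (T : R) n (alpha beta : 'M[R]_n) (i : 'I_n) u : R :=
  \sum_(j < n) (alpha i j * derivn_in `[- T, T] j u (- T) +
                beta i j * derivn_in `[- T, T] j u T).

Definition solves_problem (T : R) n (L : reflop R) (alpha beta : 'M[R]_n) h u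
    : Prop :=
  [/\ Wn1 (- T) T n u,
      {ae @lebesgue_measure R, forall t,
        `[- T, T]%classic t -> apply_op `[- T, T] L u t = h t} &
      forall i, bform T alpha beta i u = 0].

Definition reduced_bc (T : R) n (Q : reflop R) (alpha beta : 'M[R]_n) u : Prop :=
  forall i, bform T alpha beta i (apply_op `[- T, T] Q u) = 0 /\
            bform T alpha beta i u = 0.

Definition solves_homogeneous (a b : R) (S : {poly R}) (bc : (R -> R) -> Prop) u
    : Prop :=
  [/\ nderivable `[a, b] `[a, b] (size S).-1 u,
      forall t, `[a, b]%classic t -> diffop `[a, b] S u t = 0 &
      bc u].

Definition pderiv (a b : R) (k : nat) G (t s : R) : R :=
  derivn_in `[a, b] k (G ^~ s) t.

(* Green's function of [S u = 0] on [a, b] with boundary conditions [bc]; the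
   order [N] of [S] is assumed to be at least 1. *)
Definition is_green (a b : R) (S : {poly R}) (bc : (R -> R) -> Prop) G : Prop :=
  let N := (size S).-1 in
  let I := `[a, b]%classic in
  let offdiag := [set p : R * R | I p.1 /\ I p.2 /\ p.1 <> p.2] in
  [/\ forall k, (k.+2 <= N)%N ->
        (forall s, I s -> nderivable I I k (G ^~ s)) /\
        {within I `*` I, continuous (fun p => pderiv a b k G p.1 p.2)},
      forall k, k = N.-1 \/ k = N ->
        (forall s, I s -> nderivable I (I `\ s) k (G ^~ s)) /\
        {within offdiag, continuous (fun p => pderiv a b k G p.1 p.2)},
      forall t, a < t < b -> exists lm lp : R,
        [/\ pderiv a b N.-1 G t s @[s --> t^'-] --> lm,
            pderiv a b N.-1 G t s @[s --> t^'+] --> lp &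
            lm - lp = (lead_coef S)^-1],
      forall s, a < s < b -> forall t, I t -> t <> s ->
        diffop I S (G ^~ s) t = 0 &
      forall s, a < s < b -> bc (G ^~ s)].

(* R_|- G *)
Definition op_first (T : R) (Q : reflop R) G (t s : R) : R :=
  apply_op `[- T, T] Q (G ^~ s) t.

End Problems.

(* Main.v *)
Require Import Defs.
From HB Require Import structures.
From mathcomp Require Import all_boot all_order all_algebra.
From mathcomp Require Import all_classical all_reals all_analysis.
From mathcomp Require Import measurable_realfun ring lra zify.
Set Implicit Arguments.
Unset Strict Implicit.
Unset Printing Implicit Defensive.
Import Order.TTheory GRing.Theory Num.Theory.
Import numFieldNormedType.Exports.
Local Open Scope classical_set_scope.
Local Open Scope ring_scope.

(** Write phi for the reflection, L = phi a(D) + b(D), Q = phi a(D) - b(-D) for the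
companion, and S = a(-D) a(D) - b(-D) b(D).  Since D phi = - phi D, the mixed
terms cancel in both products, so Q L = S and also L Q = S.  The first identity
is the assertion about S; the second one is what makes the integral a solution.
With w(t) the integral of G(t, s) h(s), one has S w = h, hence u := Q w satisfies
L u = L Q w = h, and the conditions B_i Q w = 0 say B_i u = 0.

To keep this algebra apart from questions of differentiability, everything is
done with jets: families F : nat -> R -> R in which F j stands for the j-th
derivative.  Polynomials in D and the reflection act on all such families, and
S = Q L = L Q are identities between functions of F (op_act_companionl and
op_act_companionr).  Analysis only enters when a jet is identified with the
derivatives of a function: jet_intro for classical derivatives, sobolev_Wn1 and
Wn1_sobolev for W^{n,1}.

Existence.  The axioms of the Green's function determine G(., s) for every s in
(-T, T).  On each side of s it solves S u = 0, so it is determined by its jet at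
the end point T or - T, which is continuous in s; therefore the jump across
t = s of the derivative of order 2n - 1, prescribed along the variable s, is
also the jump along t.  Hence G(., s) is a combination of a fundamental
system plus the causal impulse response, and the boundary conditions fix the
combination, because the matrix of the boundary conditions on the solutions of
S u = 0 is invertible (green_jets).  This explicit kernel is separable, so the
integral against h can be differentiated without interchanging limits and
integrals: variation_of_constants is a product rule for sums f_k H_k in which
the H_k are merely absolutely continuous.

Uniqueness.  The boundary conditions of the problem for S contain B_i Q u and
not B_i L u, so a solution d of L d = 0, B_i d = 0 is not directly a solution of
that problem.  Instead, invertibility of the boundary matrix gives w_i in ker S
with B_j Q w_i = delta_ij; then Q w_i is in ker L, by L Q = S, and so the B_i map
ker L onto R^n.  A solution of L d = 0 is determined by d(0), ..., d^(n-1)(0)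
(reflop_uniq), because L d(t) = 0 and L d(- t) = 0 can be solved for d^(n)(t)
and d^(n)(- t) and Gronwall's inequality applies.  So ker L has dimension at
most n and the surjection is injective (kernel_uniq). *)

(** * One-sided derivatives within a set *)

Section Derivative.
Variable R : realType.
Implicit Types (I J : set R) (u v : R -> R) (t l e : R).

(** Derivative within I as a linear approximation.  The absence of a
quotient makes sums, restrictions, reflections and perturbations immediate. *)
Definition has_deriv I u t l : Prop := forall e, 0 < e ->
  \forall x \near t, I x -> `|u x - u t - l * (x - t)| <= e * `|x - t|.

Lemma has_derivP I u t l :
  (quot u t x @[x --> within I t^'] --> l) <-> has_deriv I u t l.
Proof.
split=> [|] H.
- move=> e e0; move/cvgrPdist_le : H => /(_ e e0) H.
  have H' : \forall x \near t, x != t -> I x -> `|l - quot u t x| <= e by [].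
  near=> x => Ix.
  have [->|xt] := eqVneq x t; first by rewrite !subrr mulr0 subr0 normr0 mulr0.
  have := near H' x; move=> /(_ _ xt Ix) Hx.
  have xt0 : x - t != 0 by rewrite subr_eq0.
  rewrite (_ : u x - u t - l * (x - t) = (quot u t x - l) * (x - t)); last first.
    by rewrite /quot mulrBl divfK.
  rewrite normrM distrC ler_wpM2r// Hx//.
- apply/cvgrPdist_le => e e0.
  have {}H := H e e0.
  suff : \forall x \near t, x != t -> I x -> `|l - quot u t x| <= e by [].
  near=> x => xt Ix.
  have xt0 : x - t != 0 by rewrite subr_eq0.
  have Hx : `|u x - u t - l * (x - t)| <= e * `|x - t|.
    by move: Ix; near: x; exact: H.
  have -> : l - quot u t x = - ((u x - u t - l * (x - t)) / (x - t)).
    by rewrite /quot [in RHS]mulrBl mulfK// opprB.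
  by rewrite normrN normrM normfV ler_pdivrMr// normr_gt0.
Unshelve. all: by end_near. Qed.

Lemma has_deriv_cst I k t : has_deriv I (fun=> k) t 0.
Proof.
move=> e e0; near=> x => _; rewrite subrr mul0r subr0 normr0 mulr_ge0// ltW//.
Unshelve. all: by end_near. Qed.

Lemma has_derivD I u v t l m : has_deriv I u t l -> has_deriv I v t m ->
  has_deriv I (fun x => u x + v x) t (l + m).
Proof.
move=> hu hv e e0; have e20 : 0 < e / 2 by rewrite divr_gt0.
near=> x => Ix.
have -> : u x + v x - (u t + v t) - (l + m) * (x - t)
  = (u x - u t - l * (x - t)) + (v x - v t - m * (x - t)) by ring.
rewrite (le_trans (ler_normD _ _))// [e]splitr mulrDl lerD//.
- by move: Ix; near: x; exact: hu.
- by move: Ix; near: x; exact: hv.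
Unshelve. all: by end_near. Qed.

Lemma has_derivZ I k u t l : has_deriv I u t l ->
  has_deriv I (fun x => k * u x) t (k * l).
Proof.
move=> hu e e0; have e20 : 0 < e / (`|k| + 1) by rewrite divr_gt0// ltr_wpDl.
near=> x => Ix.
have -> : k * u x - k * u t - k * l * (x - t) = k * (u x - u t - l * (x - t)).
  by ring.
have Hx : `|u x - u t - l * (x - t)| <= e / (`|k| + 1) * `|x - t|.
  by move: Ix; near: x; exact: hu.
rewrite normrM (le_trans (ler_wpM2l _ Hx))// mulrA ler_wpM2r//.
rewrite mulrCA ler_piMr ?(ltW e0)// ler_pdivrMr ?ltr_wpDl//.
by rewrite mul1r lerDl.
Unshelve. all: by end_near. Qed.

Lemma has_deriv_sum I (K : Type) (r : seq K) (P : pred K) (f : K -> R -> R)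
    (df : K -> R) t :
  (forall k, P k -> has_deriv I (f k) t (df k)) ->
  has_deriv I (fun x => \sum_(k <- r | P k) f k x) t (\sum_(k <- r | P k) df k).
Proof.
move=> H; elim: r => [|k r IH].
  rewrite big_nil (_ : (fun _ => _) = (fun=> 0)); first exact: has_deriv_cst.
  by apply/funext => x; rewrite big_nil.
rewrite big_cons (_ : (fun _ => _) =
  (fun x => if P k then f k x + \sum_(j <- r | P j) f j x
            else \sum_(j <- r | P j) f j x)).
  by case: ifP => Pk //; apply: has_derivD => //; exact: H.
by apply/funext => x; rewrite big_cons.
Qed.

Lemma has_deriv_eq I u v t l : I t -> {in I, u =1 v} ->
  has_deriv I u t l -> has_deriv I v t l.
Proof.
move=> It uv hu e e0; near=> x => Ix.
rewrite -!uv ?inE//.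
by move: Ix; near: x; exact: hu.
Unshelve. all: by end_near. Qed.

Lemma has_deriv_near I u v t l : I t -> (\forall x \near t, I x -> u x = v x) ->
  has_deriv I u t l -> has_deriv I v t l.
Proof.
move=> It uv hu e e0.
have utvt : u t = v t by exact: (nbhs_singleton uv).
near=> x => Ix.
rewrite -utvt -(_ : u x = v x).
  by move: Ix; near: x; exact: hu.
by move: Ix; near: x.
Unshelve. all: by end_near. Qed.

Lemma has_derivS I J u t l : J `<=` I -> has_deriv I u t l -> has_deriv J u t l.
Proof.
move=> JI hu e e0; near=> x => Jx.
have : I x by exact: JI.
by near: x; exact: hu.
Unshelve. all: by end_near. Qed.

Lemma has_deriv_opp I J u t l : (forall x, J x -> I (- x)) ->
  has_deriv I u (- t) l -> has_deriv J (fun x => u (- x)) t (- l).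
Proof.
move=> sI hu e e0.
have H : \forall x \near t, I (- x) ->
    `|u (- x) - u (- t) - l * (- x - - t)| <= e * `|- x - - t|.
  have /= := hu e e0; move: (@oppr_continuous _ _ t).
  by rewrite /continuous_at => /(_ _ (hu e e0)).
near=> x => Jx.
have : I (- x) by exact: sI.
rewrite (_ : - l * (x - t) = l * (- x - - t)); last by ring.
rewrite (_ : `|x - t| = `|- x - - t|); last by rewrite -opprD normrN.
by near: x; exact: H.
Unshelve. all: by end_near. Qed.

Lemma has_deriv_continuous I u t l : has_deriv I u t l ->
  u x @[x --> within I (nbhs t)] --> u t.
Proof.
move=> hu; apply/cvgrPdist_le => e e0.
suff : \forall x \near t, I x -> `|u t - u x| <= e by [].
have l0 : 0 < `|l| + 1 by rewrite ltr_wpDl.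
have el : 0 < e / (`|l| + 1) by rewrite divr_gt0.
near=> x => Ix.
have Hx : `|u x - u t - l * (x - t)| <= 1 * `|x - t|.
  by move: Ix; near: x; exact: hu.
have xt : `|t - x| < e / (`|l| + 1).
  by near: x; apply/nbhs_ballP; exists (e / (`|l| + 1)).
rewrite distrC in xt.
rewrite distrC (_ : u x - u t = (u x - u t - l * (x - t)) + l * (x - t)); last by ring.
rewrite (le_trans (ler_normD _ _))//.
rewrite (le_trans (lerD Hx (lexx _)))// normrM -mulrDl addrC.
by rewrite mulrC -ler_pdivlMr// ltW.
Unshelve. all: by end_near. Qed.

Lemma has_derivM I u v t l m : has_deriv I u t l -> has_deriv I v t m ->
  has_deriv I (fun x => u x * v x) t (l * v t + u t * m).
Proof.
move=> hu hv; apply/has_derivP.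
have -> : quot (fun x => u x * v x) t =
    (fun x => quot u t x * v x + u t * quot v t x).
  by apply/funext => x; rewrite /quot; ring.
apply: cvgD; last by apply: cvgMl_tmp; apply/has_derivP.
apply: cvgM; first exact/has_derivP.
apply: cvg_trans (has_deriv_continuous hv).
apply: cvg_app => P HP.
have {}HP : \forall x \near t, I x -> P x by [].
suff : \forall x \near t, x != t -> I x -> P x by [].
by apply: filterS HP => x Px _; exact: Px.
Qed.

Lemma has_deriv_is_derive I u t l : is_derive t 1 u l -> has_deriv I u t l.
Proof.
move=> [du ul] e e0.
have H : h^-1 *: (u (h + t) - u t) @[h --> 0^'] --> l.
  by move: du; rewrite -ul => /cvg_ex[k Hk];
   rewrite /derive; move: Hk; under eq_fun do rewrite /= [_%:A]mulr1;
   move=> Hk; have /(cvg_lim (@Rhausdorff R)) -> := Hk.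
move/cvgrPdist_le : H => /(_ e e0) H.
have {}H : \forall h \near 0, h != 0 -> `|l - h^-1 *: (u (h + t) - u t)| <= e.
  exact: H.
have H' : \forall x \near t, x - t != 0 ->
   `|l - (x - t)^-1 *: (u (x - t + t) - u t)| <= e.
  have : x - t @[x --> t] --> (0 : R).
    by rewrite -[X in _ --> X](subrr t); apply: cvgB => //; exact: cvg_cst.
  by move=> /(_ _ H).
near=> x => _.
have [->|xt] := eqVneq x t; first by rewrite !subrr mulr0 subr0 normr0 mulr0.
have xt0 : x - t != 0 by rewrite subr_eq0.
have : `|l - (x - t)^-1 *: (u (x - t + t) - u t)| <= e.
  by move: xt0; near: x; exact: H'.
rewrite subrK => Hx.
rewrite (_ : u x - u t - l * (x - t)
   = - (l - (x - t)^-1 *: (u x - u t)) * (x - t)).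
  by rewrite normrM normrN ler_wpM2r.
by rewrite /GRing.scale /= opprB mulrBl mulrAC mulVf// mul1r.
Unshelve. all: by end_near. Qed.

Lemma is_derive_has_deriv I u t l : (\forall x \near t, I x) ->
  has_deriv I u t l -> is_derive t 1 u l.
Proof.
move=> nI hu.
have H : h^-1 *: (u (h + t) - u t) @[h --> 0^'] --> l.
  apply/cvgrPdist_le => e e0.
  suff : \forall h \near 0, h != 0 -> `|l - h^-1 *: (u (h + t) - u t)| <= e by [].
  have H0 : \forall x \near t, `|u x - u t - l * (x - t)| <= e * `|x - t|.
    near=> x; have : I x by near: x.
    by near: x; exact: hu.
  have H' : \forall h \near (0 : R),
     `|u (h + t) - u t - l * (h + t - t)| <= e * `|h + t - t|.
    have : h + t @[h --> (0 : R)] --> t.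
      by rewrite -[X in _ --> X](add0r t); apply: cvgD => //; exact: cvg_cst.
    by move=> /(_ _ H0).
  near=> h => h0.
  have : `|u (h + t) - u t - l * (h + t - t)| <= e * `|h + t - t|.
    by near: h.
  rewrite addrK => Hh.
  rewrite (_ : l - _ = - ((u (h + t) - u t - l * h) / h)).
    by rewrite normrN normrM normfV ler_pdivrMr// normr_gt0.
  by rewrite /GRing.scale /= mulrBl mulfK// opprB mulrC.
have H2 : h^-1 *: (u (h *: (1:R) + t) - u t) @[h --> 0^'] --> l.
  by under eq_fun do rewrite /= [_%:A]mulr1.
split; first by apply/cvg_ex; exists l.
by apply/cvg_lim => //; exact: Rhausdorff.
Unshelve. all: by end_near. Qed.

End Derivative.

(** * Jets of functions on an interval *)

Section WithinInterval.
Variable R : realType.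
Implicit Types (J : set R) (u v : R -> R) (t l : R).

(** Every point of a nondegenerate interval is a limit point of it, end points
included; this is what makes limits of difference quotients unique. *)
Lemma within_itv_proper (a b t : R) : a < b -> `[a, b]%classic t ->
  ProperFilter (within `[a, b] t^').
Proof.
move=> ab; rewrite /= in_itv/= => /andP[at_ tb].
apply: Build_ProperFilter_ex => P HP.
have {}HP : \forall x \near t, x != t -> `[a, b]%classic x -> P x by [].
have /nbhs_ballP[d /= d0 HP'] := HP.
suff [x xd [xt Ix]] : exists2 x, `|t - x| < d & x != t /\ `[a, b]%classic x.
  by exists x; apply: HP'.
have [tb'|bt] := ltP t b.
- exists (t + Num.min (d / 2) (b - t)).
    rewrite opprD addNKr normrN gtr0_norm; last first.
      by rewrite lt_min divr_gt0//= subr_gt0.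
    by rewrite gt_min; apply/orP; left; rewrite ltr_pdivrMr// mulr2n mulrDr mulr1 ltrDl.
  have m0 : 0 < Num.min (d / 2) (b - t) by rewrite lt_min divr_gt0//= subr_gt0.
  split; first by rewrite gt_eqF// ltrDl.
  rewrite /= in_itv/=; apply/andP; split; first by rewrite (le_trans at_)// lerDl ltW.
  by rewrite -lerBrDl ge_min lexx orbT.
- have a_t : 0 < t - a by rewrite subr_gt0 (lt_le_trans ab).
  exists (t - Num.min (d / 2) (t - a)).
    rewrite opprB addrC subrK gtr0_norm; last by rewrite lt_min divr_gt0.
    by rewrite gt_min; apply/orP; left; rewrite ltr_pdivrMr// mulr2n mulrDr mulr1 ltrDl.
  have m0 : 0 < Num.min (d / 2) (t - a) by rewrite lt_min divr_gt0.
  split; first by rewrite lt_eqF// ltrBlDr ltrDl.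
  rewrite /= in_itv/=; apply/andP; split.
    by rewrite lerBrDr -lerBrDl ge_min lexx orbT.
  by rewrite (le_trans _ tb)// lerBlDr lerDl ltW.
Qed.

Lemma has_deriv_deriv_in (a b t : R) u l : a < b -> `[a, b]%classic t ->
  has_deriv `[a, b] u t l -> derivable_in `[a, b] u t /\ deriv_in `[a, b] u t = l.
Proof.
move=> ab It /has_derivP H; have PF := within_itv_proper ab It; split.
  by apply/cvg_ex; exists l.
by apply/cvg_lim => //; exact: Rhausdorff.
Qed.

Lemma derivable_in_has_deriv (I : set R) t u : derivable_in I u t ->
  has_deriv I u t (deriv_in I u t).
Proof. by move=> H; apply/has_derivP. Qed.

Lemma has_deriv_unique (a b t : R) u l m : a < b -> `[a, b]%classic t ->
  has_deriv `[a, b] u t l -> has_deriv `[a, b] u t m -> l = m.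
Proof.
by move=> ab It /(has_deriv_deriv_in ab It)[_ <-] /(has_deriv_deriv_in ab It)[_ <-].
Qed.

(** Relatively open subsets are needed because Green's function is only smooth
away from the diagonal, while derivatives are always taken within the whole
interval. *)
Definition relopen (I J : set R) :=
  J `<=` I /\ forall t, J t -> \forall x \near t, I x -> J x.

Definition jet_of (I J : set R) (m : nat) v (W : nat -> R -> R) :=
  nderivable I J m v /\
  forall j, (j <= m)%N -> forall t, J t -> derivn_in I j v t = W j t.

(** By induction on j: on a relatively open set, the j-th iterated derivative of v
coincides with W j near each point, so it inherits the derivative of W j. *)
Lemma jet_intro (a b : R) J m v (W : nat -> R -> R) : a < b ->
  relopen `[a, b] J -> (forall t, J t -> v t = W 0 t) ->
  (forall j t, (j < m)%N -> J t -> has_deriv `[a, b] (W j) t (W j.+1 t)) ->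
  jet_of `[a, b] J m v W.
Proof.
move=> ab [JI oJ] v0 dW.
have key j : (j <= m)%N -> forall t, J t -> derivn_in `[a, b] j v t = W j t.
  elim: j => [_|j IH jm] t Jt; first exact: v0.
  have := has_deriv_deriv_in ab (JI _ Jt) (u := derivn_in `[a, b] j v) (l := W j.+1 t).
  move=> H; apply H => {H}.
  apply: has_deriv_near (dW _ _ jm Jt); first exact: JI.
  have := oJ _ Jt; apply: filterS => x Jx Ix; rewrite IH ?(ltnW jm)//.
  exact: Jx.
split=> // j jm t Jt.
have := has_deriv_deriv_in ab (JI _ Jt) (u := derivn_in `[a, b] j v) (l := W j.+1 t).
move=> H; apply H => {H}.
apply: has_deriv_near (dW _ _ jm Jt); first exact: JI.
have := oJ _ Jt; apply: filterS => x Jx Ix; rewrite key ?(ltnW jm)//.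
exact: Jx.
Qed.

Lemma nderivable_has_deriv (I J : set R) m v j t : nderivable I J m v ->
  (j < m)%N -> J t -> has_deriv I (derivn_in I j v) t (derivn_in I j.+1 v t).
Proof. by move=> H jm Jt; apply: derivable_in_has_deriv; exact: H. Qed.

Lemma jet_has_deriv (a b : R) J m v W j t :
  relopen `[a, b] J -> jet_of `[a, b] J m v W ->
  (j < m)%N -> J t -> has_deriv `[a, b] (W j) t (W j.+1 t).
Proof.
move=> [JI oJ] [dv Wv] jm Jt; rewrite -Wv//.
apply: has_deriv_near (nderivable_has_deriv dv jm Jt); first exact: JI.
by have := oJ _ Jt; apply: filterS => x Jx Ix; rewrite Wv ?(ltnW jm)//; exact: Jx.
Qed.

End WithinInterval.

(** * The algebra of differential operators with reflection on jets *)

Section Families.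
Variable R : realType.
Implicit Types (F G : nat -> R -> R) (p q : {poly R}) (P : reflop R).

(** The polynomial p in D, with D acting on jets as the shift. *)
Definition poly_act p F : nat -> R -> R :=
  fun j t => \sum_(k < size p) p`_k * F (k + j)%N t.
(** The jet of t |-> f (- t) when F is the jet of f. *)
Definition jet_refl F : nat -> R -> R := fun j t => (-1) ^+ j * F j (- t).
Definition jet_add F G : nat -> R -> R := fun j t => F j t + G j t.
Definition op_act P F : nat -> R -> R :=
  jet_add (jet_refl (poly_act (refl_part P) F)) (poly_act (diff_part P) F).
Definition poly_refl p : {poly R} := \poly_(l < size p) ((-1) ^+ l * p`_l).

Lemma poly_actE m p F j t : (size p <= m)%N ->
  poly_act p F j t = \sum_(k < m) p`_k * F (k + j)%N t.
Proof.
move=> pm; rewrite /poly_act.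
rewrite (big_ord_widen _ (fun k => p`_k * F (k + j)%N t) pm) big_mkcond /=.
apply: eq_bigr => k _; case: ltnP => // pk.
by rewrite nth_default// mul0r.
Qed.

Lemma poly_actDl p q F : poly_act (p + q) F = jet_add (poly_act p F) (poly_act q F).
Proof.
apply/funext => j; apply/funext => t.
have pm := leq_maxl (size p) (size q); have qm := leq_maxr (size p) (size q).
rewrite /jet_add (poly_actE _ _ _ pm) (poly_actE _ _ _ qm).
rewrite (poly_actE _ _ _ (size_polyD p q)) -big_split /=.
by apply: eq_bigr => k _; rewrite coefD mulrDl.
Qed.

Lemma poly_actDr p F G : poly_act p (jet_add F G) = jet_add (poly_act p F) (poly_act p G).
Proof.
apply/funext => j; apply/funext => t; rewrite /jet_add /poly_act -big_split /=.
by apply: eq_bigr => k _; rewrite mulrDr.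
Qed.

Lemma poly_actC (c : R) F : poly_act c%:P F = fun j t => c * F j t.
Proof.
apply/funext => j; apply/funext => t.
by rewrite (@poly_actE 1) ?size_polyC_leq1// big_ord1 coefC.
Qed.

Lemma poly_actMX p F : poly_act (p * 'X) F = poly_act p (fun j => F j.+1).
Proof.
apply/funext => j; apply/funext => t.
have [->|p0] := eqVneq p 0; first by rewrite mul0r /poly_act size_poly0 !big_ord0.
rewrite /poly_act size_mulX// big_ord_recl coefMX /= mul0r add0r.
apply: eq_bigr => k _; by rewrite coefMX /= /bump add0n leq0n add1n addSn.
Qed.

Lemma poly_actM p q F : poly_act (p * q) F = poly_act p (poly_act q F).
Proof.
elim/poly_ind: p F => [|p c IH] F.
  by rewrite mul0r; apply/funext => j; apply/funext => t;
    rewrite /poly_act size_poly0 !big_ord0.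
rewrite mulrDl -mulrA ['X * q]mulrC mulrA !poly_actDl !poly_actMX IH !poly_actC.
congr jet_add.
  congr poly_act; apply/funext => j; apply/funext => t.
  by rewrite /poly_act; apply: eq_bigr => k _; rewrite addnS.
apply/funext => j; apply/funext => t.
have sz : (size (c%:P * q)%R <= size q)%N.
  by rewrite mul_polyC size_scale_leq.
rewrite (poly_actE _ _ _ sz) mulr_sumr; apply: eq_bigr => k _.
by rewrite coefCM mulrA.
Qed.

Lemma poly_refl_coef p k : (poly_refl p)`_k = (-1) ^+ k * p`_k.
Proof.
by rewrite coef_poly; case: ltnP => // pk; rewrite [p`_k]nth_default// mulr0.
Qed.

Lemma size_poly_refl p : (size (poly_refl p) <= size p)%N.
Proof. exact: size_poly. Qed.

(** D phi = - phi D. *)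
Lemma poly_act_jet_refl p F : poly_act p (jet_refl F) = jet_refl (poly_act (poly_refl p) F).
Proof.
apply/funext => j; apply/funext => t.
rewrite /jet_refl (poly_actE _ _ _ (size_poly_refl p)) /poly_act mulr_sumr;
  apply: eq_bigr => k _.
by rewrite poly_refl_coef exprD; ring.
Qed.

Lemma jet_reflK F : jet_refl (jet_refl F) = F.
Proof.
apply/funext => j; apply/funext => t.
by rewrite /jet_refl mulrA -expr2 sqrr_sign mul1r opprK.
Qed.

Lemma jet_reflD F G : jet_refl (jet_add F G) = jet_add (jet_refl F) (jet_refl G).
Proof. by apply/funext => j; apply/funext => t; rewrite /jet_refl /jet_add mulrDr. Qed.

Definition reduced_poly P : {poly R} :=
  poly_refl (refl_part P) * refl_part P - poly_refl (diff_part P) * diff_part P.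

Lemma companion_diff P : diff_part (companion P) = - poly_refl (diff_part P).
Proof.
apply/polyP => k; rewrite coefN poly_refl_coef coef_poly; case: ltnP => pk.
  by rewrite exprS mulN1r mulNr.
by rewrite nth_default// mulr0 oppr0.
Qed.

Lemma poly_actN p F : poly_act (- p) F = fun j t => - poly_act p F j t.
Proof.
apply/funext => j; apply/funext => t; rewrite /poly_act size_polyN -sumrN.
by apply: eq_bigr => k _; rewrite coefN mulNr.
Qed.

(** The cross terms phi a(D) b(D) and - b(-D) phi a(D) = - phi b(D) a(D) cancel. *)
Lemma op_act_companionl P F :
  op_act (companion P) (op_act P F) = poly_act (reduced_poly P) F.
Proof.
rewrite /op_act companion_diff /= /reduced_poly poly_actDl !poly_actDr
  !poly_act_jet_refl !jet_reflD jet_reflK.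
rewrite (_ : poly_refl (- poly_refl (diff_part P)) = - diff_part P); last first.
  by apply/polyP => k; rewrite coefN poly_refl_coef coefN poly_refl_coef mulrN mulrA -expr2
       sqrr_sign mul1r.
rewrite -!poly_actM ?mulNr [diff_part P * _]mulrC !poly_actN.
apply/funext => j; apply/funext => t; rewrite /jet_add /jet_refl.
by ring.
Qed.

(** The companion also commutes with P; this second factorization is the one used
to solve P u = h. *)
Lemma op_act_companionr P F :
  op_act P (op_act (companion P) F) = poly_act (reduced_poly P) F.
Proof.
rewrite /op_act companion_diff /= /reduced_poly poly_actDl !poly_actDr
  !poly_act_jet_refl !jet_reflD jet_reflK.
rewrite -!poly_actM ?mulrN [refl_part P * poly_refl _]mulrC [diff_part P * poly_refl
  _]mulrC !poly_actN.
by apply/funext => j; apply/funext => t; rewrite /jet_add /jet_refl; ring.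
Qed.

Lemma op_actE m P F j t :
  (size (refl_part P) <= m)%N -> (size (diff_part P) <= m)%N ->
  op_act P F j t = \sum_(k < m) ((-1) ^+ j * (refl_part P)`_k * F (k + j)%N (- t) +
                              (diff_part P)`_k * F (k + j)%N t).
Proof.
move=> h1 h2; rewrite /op_act /jet_add /jet_refl (poly_actE _ _ _ h1) (poly_actE _ _ _ h2).
by rewrite mulr_sumr -big_split; apply: eq_bigr => k _; rewrite mulrA.
Qed.

End Families.

(** * Operators with reflection applied to functions *)

Section ApplyOp.
Variable R : realType.
Variable T : R.
Hypothesis T0 : 0 < T.
Notation I := `[- T, T]%classic.

Lemma sym_itv (x : R) : I x -> I (- x).
Proof. by rewrite /= !in_itv/= lerN2 lerNl andbC. Qed.

Lemma oppT_lt : - T < T. Proof. by rewrite (lt_trans _ T0)// oppr_lt0. Qed.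

Lemma op_act_has_deriv (P : reflop R) (F : nat -> R -> R) p j t :
  (size (refl_part P) <= p.+1)%N -> (size (diff_part P) <= p.+1)%N ->
  (forall k, (k <= j + p)%N -> has_deriv I (F k) t (F k.+1 t)) ->
  (forall k, (k <= j + p)%N -> has_deriv I (F k) (- t) (F k.+1 (- t))) ->
  has_deriv I (op_act P F j) t (op_act P F j.+1 t).
Proof.
move=> h1 h2 dF dF'; rewrite (_ : op_act P F j = (fun x => \sum_(k < p.+1)
   ((-1) ^+ j * (refl_part P)`_k * F (k + j)%N (- x) +
                              (diff_part P)`_k * F (k + j)%N x))); last first.
  by apply/funext => x; apply: op_actE.
rewrite (op_actE _ _ _ h1 h2); apply: has_deriv_sum => k _.
have kp : (k + j <= j + p)%N by rewrite addnC leq_add2l -ltnS.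
apply: has_derivD.
  rewrite exprS addnS mulN1r !mulNr -mulrN; apply: has_derivZ.
  by apply: has_deriv_opp; [exact: sym_itv|exact: dF'].
by rewrite addnS; apply: has_derivZ; apply: dF.
Qed.

(** Each order of derivation of apply_op P v costs the order p of P; J must be
symmetric because the value at t involves v near t and near - t. *)
Lemma jet_apply_op (J : set R) (P : reflop R) v (W : nat -> R -> R) m p :
  relopen I J -> (forall t, J t -> J (- t)) ->
  (size (refl_part P) <= p.+1)%N -> (size (diff_part P) <= p.+1)%N ->
  jet_of I J (m + p) v W -> jet_of I J m (apply_op I P v) (op_act P W).
Proof.
move=> oJ sJ h1 h2 jv; apply: jet_intro => //; first exact: oppT_lt.
  move=> t Jt; rewrite /apply_op /pullback /diffop /op_act /jet_add /jet_refl mul1r.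
  case: jv => _ Wv; congr (_ + _); apply: eq_bigr => k _; rewrite addn0 Wv//.
  - by rewrite (leq_trans _ (leq_addl m p))// -ltnS (leq_trans _ h1).
  - exact: sJ.
  - by rewrite (leq_trans _ (leq_addl m p))// -ltnS (leq_trans _ h2).
move=> j t jm Jt; apply: (op_act_has_deriv h1 h2) => k kjp.
- apply: (jet_has_deriv oJ jv) => //.
  by rewrite (leq_ltn_trans kjp)// ltn_add2r.
- apply: (jet_has_deriv oJ jv) => //; last exact: sJ.
  by rewrite (leq_ltn_trans kjp)// ltn_add2r.
Qed.

Lemma relopen_refl (I' : set R) : relopen I' I'.
Proof. by split=> // t It; near=> x. Unshelve. all: by end_near. Qed.

Lemma comp_companion (L : reflop R) : comp_is_diffop I (companion L) L (reduced_poly L).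
Proof.
move=> u su t It.
pose U j := derivn_in I j u.
have jU m : jet_of I I m u U by split=> //; exact: su.
pose p := maxn (size (refl_part L)) (size (diff_part L)).
have h1 : (size (refl_part L) <= p.+1)%N by rewrite ltnW// ltnS leq_maxl.
have h2 : (size (diff_part L) <= p.+1)%N by rewrite ltnW// ltnS leq_maxr.
have h3 : (size (diff_part (companion L)) <= p.+1)%N.
  by rewrite (leq_trans (size_poly _ _))//.
have jLU := jet_apply_op (m := p) (relopen_refl I) sym_itv h1 h2 (jU _).
have := jet_apply_op (P := companion L) (m := 0) (relopen_refl I) sym_itv h1 h3 jLU.
move=> [_ /(_ 0 (leqnn _) t It)] /= ->; rewrite op_act_companionl /poly_act /diffop.
by apply: eq_bigr => k _; rewrite addn0.
Qed.

End ApplyOp.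

(** * Gronwall's inequality *)

Section Gronwall.
Variable R : realType.

Lemma has_deriv_continuous_itv (a b : R) (u u' : R -> R) :
  (forall t, `[a, b]%classic t -> has_deriv `[a, b] u t (u' t)) ->
  {within `[a, b], continuous u}.
Proof.
by move=> du; apply/subspace_continuousP => t It; exact: (has_deriv_continuous (du t It)).
Qed.

Lemma has_deriv_nincr (c d : R) (u u' : R -> R) : c <= d ->
  (forall t, `[c, d]%classic t -> has_deriv `[c, d] u t (u' t)) ->
  (forall t, `[c, d]%classic t -> u' t <= 0) -> u d <= u c.
Proof.
rewrite le_eqVlt => /predU1P[-> //|cd] du u'0.
have [|x xcd ucd] := MVT (f := u) (df := u') cd _ (has_deriv_continuous_itv du).
  move=> x xcd; apply: (@is_derive_has_deriv _ `[c, d]).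
    have := near_in_itvoo xcd; apply: filterS => y /= .
    by rewrite !in_itv/= => /andP[? ?]; rewrite !ltW.
  by apply: du; apply: subset_itv_oo_cc; exact: xcd.
rewrite -subr_le0 ucd mulr_le0_ge0// ?subr_ge0 ?(ltW cd)// u'0//.
by apply: subset_itv_oo_cc; exact: xcd.
Qed.

Lemma gronwall_fwd (K : finType) (f f' : K -> R -> R) (c d C : R) :
  0 <= C ->
  (forall k t, `[c, d]%classic t -> has_deriv `[c, d] (f k) t (f' k t)) ->
  (forall k t, `[c, d]%classic t -> `|f' k t| <= C * \sum_j `|f j t|) ->
  (forall k, f k c = 0) ->
  forall k t, `[c, d]%classic t -> f k t = 0.
Proof.
move=> C0 df bf f0 k0 t0 It0.
have sub t : `[c, t0]%classic t -> `[c, d]%classic t.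
  move: It0; rewrite /= !in_itv/= => /andP[_ h] /andP[-> h']/=.
  exact: le_trans h.
have ct0 : c <= t0 by move: It0; rewrite /= in_itv/= => /andP[].
pose A := 2 * C * #|K|%:R.
(* The energy E = sum_k f_k^2 satisfies E' <= A E, so E exp (- A t) is nonincreasing. *)
pose E t := \sum_k f k t * f k t.
pose E' t := \sum_k (f' k t * f k t + f k t * f' k t).
have dE t : `[c, t0]%classic t -> has_deriv `[c, t0] E t (E' t).
  move=> It; apply: has_deriv_sum => k _.
  by apply: has_derivM; apply: (has_derivS sub); apply: df; apply: sub.
have E'le t : `[c, t0]%classic t -> E' t <= A * E t.
  move=> /sub It.
  have -> : A * E t = \sum_k \sum_j C * (f k t * f k t + f j t * f j t).
    under eq_bigr => k _.
      rewrite -mulr_sumr big_split /= -/(E t) sumr_const -mulr_natr mulrC mulrDl.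
      over.
    rewrite big_split /= sumr_const -2!mulr_suml -/(E t) -mulr_natr /A.
    by ring.
  apply: ler_sum => k _.
  have -> : f' k t * f k t + f k t * f' k t = 2 * (f' k t * f k t) by ring.
  have h1 : f' k t * f k t <= C * (\sum_j `|f j t|) * `|f k t|.
    by rewrite (le_trans (ler_norm _))// normrM ler_wpM2r// bf.
  have h2 : 2 * (f' k t * f k t) <= 2 * (C * (\sum_j `|f j t|) * `|f k t|).
    by rewrite ler_wpM2l.
  rewrite (le_trans h2)//.
  have -> : 2 * (C * (\sum_j `|f j t|) * `|f k t|) =
     \sum_j C * (2 * (`|f j t| * `|f k t|)).
    by rewrite -mulr_sumr -mulr_sumr -mulr_suml; ring.
  apply: ler_sum => j _; apply: ler_wpM2l => //.
  have := sqr_ge0 (`|f j t| - `|f k t|).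
  rewrite sqrrB !real_normK ?num_real// !expr2 -mulr_natl.
  by lra.
pose g t := E t * expR (- A * t).
pose g' t := E' t * expR (- A * t) + E t * (- A * expR (- A * t)).
have dg t : `[c, t0]%classic t -> has_deriv `[c, t0] g t (g' t).
  move=> It; apply: has_derivM; first exact: dE.
  apply: has_deriv_is_derive.
  have := @is_derive1_comp _ expR (fun x => - A * x) t (expR (- A * t)) (- A)
     (is_derive_expR _) _.
  rewrite mulrC; apply.
  have := @is_deriveZ _ _ _ id (- A) t 1 1 (is_derive_id _ _).
  by rewrite /GRing.scale /= mulr1.
have g'0 t : `[c, t0]%classic t -> g' t <= 0.
  move=> It; have -> : g' t = (E' t - A * E t) * expR (- A * t) by rewrite /g'; ring.
  by rewrite mulr_le0_ge0 ?expR_ge0// subr_le0 E'le.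
have := has_deriv_nincr ct0 dg g'0.
have -> : g c = 0 by rewrite /g /E big1 ?mul0r// => k _; rewrite f0 mul0r.
rewrite /g pmulr_lle0 ?expR_gt0// => Ele0.
have E0 : E t0 == 0.
  by rewrite eq_le Ele0 sumr_ge0// => k _; rewrite -expr2 sqr_ge0.
move: E0; rewrite psumr_eq0; last by move=> k _; rewrite -expr2 sqr_ge0.
by move=> /allP/(_ k0); rewrite mem_index_enum => /(_ isT);
  rewrite /= mulf_eq0 orbb => /eqP.
Qed.

(** The indices range over a finite type so that the functions F j and
F j (- t) of a reflection equation can be treated as one system. *)
Lemma gronwall (K : finType) (f f' : K -> R -> R) (c d C s : R) :
  0 <= C -> `[c, d]%classic s ->
  (forall k t, `[c, d]%classic t -> has_deriv `[c, d] (f k) t (f' k t)) ->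
  (forall k t, `[c, d]%classic t -> `|f' k t| <= C * \sum_j `|f j t|) ->
  (forall k, f k s = 0) ->
  forall k t, `[c, d]%classic t -> f k t = 0.
Proof.
move=> C0 Is df bf f0 k t It.
move: (Is) (It); rewrite /= !in_itv/= => /andP[cs sd] /andP[ct td].
have [st|ts] := leP s t.
- have sub x : `[s, d]%classic x -> `[c, d]%classic x.
    by rewrite /= !in_itv/= => /andP[sx ->]; rewrite (le_trans cs sx).
  apply: (@gronwall_fwd _ f f' s d C) => //.
  + by move=> j x Ix; apply: (has_derivS sub); apply: df; exact: sub.
  + by move=> j x /sub; exact: bf.
  + by rewrite /= in_itv/= st td.
- have sub x : `[- s, - c]%classic x -> `[c, d]%classic (- x).
    rewrite /= !in_itv/= lerNl => /andP[sx xc]; rewrite lerNr xc/=.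
    exact: le_trans sx sd.
  suff : (fun k x => f k (- x)) k (- t) = 0 by rewrite /= opprK.
  apply: (@gronwall_fwd _ (fun k x => f k (- x)) (fun k x =>
    - f' k (- x)) (- s) (- c) C C0).
  + by move=> j x Ix; apply: (has_deriv_opp sub); apply: df; exact: sub.
  + by move=> j x /sub; rewrite normrN; exact: bf.
  + by move=> j; rewrite opprK.
  + by rewrite /= in_itv/= !lerN2 ct ltW.
Qed.

End Gronwall.

(** * Linear equations with constant coefficients *)

Section LinearODE.
Variable R : realType.
Variables (S : {poly R}).
Hypothesis S1 : (1 < size S)%N.
Notation N := (size S).-1.

Let SN0 : S`_N != 0.
Proof. by rewrite -lead_coefE lead_coef_eq0 -size_poly_gt0 ltnW. Qed.

Let sizeS : size S = N.+1. Proof. by rewrite prednK// ltnW. Qed.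

Lemma poly_act_solve (F : nat -> R -> R) j t : poly_act S F j t = 0 ->
  F (N + j)%N t = - \sum_(i < N) S`_i / S`_N * F (i + j)%N t.
Proof.
rewrite /poly_act sizeS big_ord_recr /= => /eqP; rewrite addrC addr_eq0 => /eqP H.
apply: (mulfI SN0); rewrite H mulrN mulr_sumr; congr (- _); apply: eq_bigr => i _.
by rewrite !mulrA [S`_N * _]mulrC mulfK.
Qed.

Lemma ode_uniq (F : nat -> R -> R) (c d s : R) : `[c, d]%classic s ->
  (forall j t, (j < N)%N -> `[c, d]%classic t -> has_deriv `[c, d] (F j) t (F j.+1 t)) ->
  (forall t, `[c, d]%classic t -> poly_act S F 0 t = 0) ->
  (forall j, (j < N)%N -> F j s = 0) ->
  forall j t, (j < N)%N -> `[c, d]%classic t -> F j t = 0.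
Proof.
move=> Is dF SF Fs j t jN It.
pose C := 1 + \sum_(i < N) `|S`_i / S`_N|.
have C0 : 0 <= C by rewrite addr_ge0// sumr_ge0.
apply: (@gronwall _ 'I_N (fun k => F k) (fun k => F k.+1) c d C s C0 Is _ _ _
   (Ordinal jN) t It).
- by move=> k x Ix; apply: dF.
- move=> k x Ix.
  have [kN|] := ltnP k.+1 N.
    have h : `|F k.+1 x| <= \sum_(j0 < N) `|F j0 x|.
      by rewrite (bigD1 (Ordinal kN)) //= lerDl sumr_ge0.
    rewrite (le_trans h)// ler_peMl ?sumr_ge0// lerDl sumr_ge0//.
  move=> Nk; have kN : k.+1 = N by apply/eqP; rewrite eqn_leq Nk andbT.
  have /poly_act_solve := SF x Ix; rewrite addn0 kN => ->.
  rewrite normrN (le_trans (ler_norm_sum _ _ _))//.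
  rewrite mulrDl mul1r ler_wpDl ?sumr_ge0// mulr_suml; apply: ler_sum => i _.
  rewrite addn0 normrM ler_wpM2l// (bigD1 i)//= lerDl sumr_ge0//.
- by move=> k; apply: Fs.
Qed.

Section Existence.
Variable x : nat -> R.

(** The Taylor coefficients of a solution obey a linear recursion of order N; its
state is the window of the next N coefficients, stored as a function of the
position in the window. *)
Fixpoint rec_state (m : nat) : nat -> R :=
  if m is m'.+1 then
    fun i => if (i.+1 < N)%N then rec_state m' i.+1
             else - \sum_(k < N) S`_k / S`_N * rec_state m' k
  else x.

Let cf m := rec_state m 0.

Lemma rec_stateE m i : (i < N)%N -> rec_state m i = cf (m + i).
Proof.
elim: i m => [|i IH] m iN; first by rewrite addn0.
by rewrite addnS -addSn -IH ?(ltnW iN)//= iN.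
Qed.

Lemma cf_rec j : \sum_(k < size S) S`_k * cf (k + j) = 0.
Proof.
rewrite sizeS big_ord_recr /=.
have N0 : (0 < N)%N by rewrite -ltnS -sizeS.
have -> : cf (N + j) = - \sum_(k < N) S`_k / S`_N * rec_state j k.
  have -> : (N + j = j.+1 + N.-1)%N by rewrite addSnnS prednK// addnC.
  by rewrite -rec_stateE ?prednK//= prednK// ltnn.
apply/eqP; rewrite addr_eq0 mulrN opprK mulr_sumr; apply/eqP/eq_bigr => i _.
by rewrite rec_stateE// [S`_N * _]mulrA [S`_N * _]mulrC divfK// addnC.
Qed.

(** The coefficients grow at most geometrically, so that dividing by the factorials
gives an entire power series. *)
Lemma cf_bound : exists2 M : R, 0 <= M & exists2 X : R, 0 <= X &
  forall m, `|cf m| <= X * M ^+ m.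
Proof.
pose C := 1 + \sum_(i < N) `|S`_i / S`_N|.
have C1 : 1 <= C by rewrite lerDl sumr_ge0.
exists C; first by rewrite (le_trans _ C1).
exists (\sum_(i < N) `|x i|); first by rewrite sumr_ge0.
have N0 : (0 < N)%N by rewrite -ltnS -sizeS.
move=> m; suff: forall i, (i < N)%N -> `|rec_state m i| <= (\sum_(i < N) `|x i|) * C ^+ m.
  by move=> /(_ 0 N0).
elim: m => [i iN|m IH i iN] /=.
  by rewrite mulr1 (bigD1 (Ordinal iN)) //= lerDl sumr_ge0.
have CX0 : 0 <= (\sum_(i0 < N) `|x i0|) * C ^+ m.
  by rewrite mulr_ge0 ?sumr_ge0// exprn_ge0// (le_trans _ C1).
rewrite exprSr mulrA.
case: ifPn => h.
  by rewrite (le_trans (IH _ h))// ler_peMr.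
rewrite normrN (le_trans (ler_norm_sum _ _ _))//.
rewrite mulrDr mulr1 ler_wpDl// mulr_sumr; apply: ler_sum => k _.
by rewrite normrM mulrC ler_wpM2r// IH.
Qed.

Let pc j : nat -> R := fun k => cf (k + j) / k`!%:R.

Lemma is_cvg_pc j t : cvgn (pseries (pc j) t).
Proof.
have [M M0 [X X0 cfb]] := cf_bound.
apply: normed_cvg.
apply: (@series_le_cvg _ _ (fun k => (X * M ^+ j) * exp_coeff (M * `|t|) k)) => //=.
- by move=> k; rewrite mulr_ge0 ?exp_coeff_ge0 ?mulr_ge0 ?exprn_ge0.
- move=> k; rewrite /pc /exp_coeff /= !normrM normrX normfV [`|_%:R|]ger0_norm//.
  rewrite mulrAC mulrA ler_wpM2r ?invr_ge0// exprMn.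
  rewrite (_ : X * _ * _ = X * M ^+ (k + j) * `|t| ^+ k).
    by rewrite ler_wpM2r// exprn_ge0.
  by rewrite exprD; ring.
- apply: is_cvg_seriesZ; exact: is_cvg_series_exp_coeff.
Qed.

Lemma pc_diffs j : pseries_diffs (pc j) = pc j.+1.
Proof.
apply/funext => k; rewrite /pseries_diffs /pc factS natrM addnS addSn.
have h1 : (k.+1%:R : R) != 0 by rewrite pnatr_eq0.
by rewrite invfM mulrCA mulVKf.
Qed.

Lemma ode_exists : exists E : nat -> R -> R,
  [/\ forall (j : nat) (t : R), is_derive t 1 (E j) (E j.+1 t),
      forall j, (j < N)%N -> E j 0 = x j &
      forall j t, poly_act S E j t = 0].
Proof.
exists (fun j t => limn (pseries (pc j) t)); split.
- move=> j t.
  have := @pseries_snd_diffs R (pc j) (`|t| + 1) t.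
  rewrite !pc_diffs => /(_ (@is_cvg_pc _ _) (@is_cvg_pc _ _) (@is_cvg_pc _ _)); apply.
  by rewrite [ltRHS]ger0_norm ?addr_ge0// ltrDl.
- move=> j jN.
  apply/cvg_lim; first exact: Rhausdorff.
  apply: cvg_near_cst; near=> n.
  have n0 : (0 < n)%N by near: n; exists 1%N.
  rewrite /pseries /series /= big_ltn// big_nat_cond big1 ?addr0.
    by rewrite /pc add0n fact0 divr1 expr0 mulr1 -(rec_stateE 0).
  by move=> i /andP[/andP[i0 _] _]; rewrite expr0n gtn_eqF// mulr0.
- move=> j t; rewrite /poly_act.
  have H : (fun n => \sum_(k < size S) S`_k * pseries (pc (k + j)) t n) @ \oo -->
     \sum_(k < size S) S`_k * limn (pseries (pc (k + j)) t).
    apply: cvg_big => [|k _]; first exact: add_continuous.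
    by apply: cvgM; [exact: cvg_cst|exact: is_cvg_pc].
  have H0 : (fun n => \sum_(k < size S) S`_k * pseries (pc (k + j)) t n) = fun=> 0.
    apply/funext => n; rewrite /pseries /series /=.
    under eq_bigr do rewrite mulr_sumr.
    rewrite exchange_big /= big1// => i _.
    rewrite (_ : \sum_(k < size S) _ =
      (\sum_(k < size S) S`_k * cf (k + (i + j))) * (t ^+ i / i`!%:R)).
      by rewrite cf_rec mul0r.
    rewrite mulr_suml; apply: eq_bigr => k _; rewrite /pc.
    by rewrite addnCA -!mulrA; congr (_ * (_ * _)); rewrite mulrC.
  rewrite H0 in H.
  have /(cvg_lim (@Rhausdorff R)) := H.
  by rewrite lim_cst.
Unshelve. all: by end_near. Qed.

End Existence.

Definition fundsys (e : nat -> nat -> R -> R) :=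
  [/\ forall (k j : nat) (t : R), is_derive t 1 (e k j) (e k j.+1 t),
      forall k j, (j < N)%N -> e k j 0 = (j == k)%:R &
      forall k j t, poly_act S (e k) j t = 0].

Lemma fundsys_exists : exists e, fundsys e.
Proof.
have /choice[e He] : forall k, exists E : nat -> R -> R,
  [/\ forall (j : nat) (t : R), is_derive t 1 (E j) (E j.+1 t),
      forall j, (j < N)%N -> E j 0 = (j == k)%:R &
      forall j t, poly_act S E j t = 0].
  by move=> k; exact: ode_exists.
by exists e; split => k; have [] := He k.
Qed.

(** The difference of the two sides solves the equation with zero data at s. *)
Lemma fundsys_expand e F (c d s : R) : fundsys e -> `[c, d]%classic s ->
  (forall j t, (j < N)%N -> `[c, d]%classic t -> has_deriv `[c, d] (F j) t (F j.+1 t)) ->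
  (forall t, `[c, d]%classic t -> poly_act S F 0 t = 0) ->
  forall j t, (j < N)%N -> `[c, d]%classic t ->
    F j t = \sum_(k < N) F k s * e k j (t - s).
Proof.
move=> [de e0 Se] Is dF SF j t jN It.
pose G j t := F j t + \sum_(k < N) - F k s * e k j (t - s).
suff : G j t = 0.
  move=> /eqP; rewrite addr_eq0 => /eqP ->; rewrite -sumrN.
  by apply: eq_bigr => k _; rewrite mulNr opprK.
apply: (ode_uniq (F := G) (s := s) Is) => //.
- move=> i u iN Iu; apply: has_derivD; first exact: dF.
  apply: has_deriv_sum => k _; apply: has_derivZ.
  apply: has_deriv_is_derive.
  have := @is_derive1_comp _ (e k i) (fun x => x - s) u _ 1 (de k i (u - s)) _.
  rewrite mulr1; apply.
  have := @is_deriveB _ _ _ id (cst s) u 1 _ _ (is_derive_id _ _) (is_derive_cst _ _ _).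
  by rewrite subr0.
- move=> u Iu; rewrite /poly_act /G; under eq_bigr do rewrite mulrDr mulr_sumr.
  rewrite big_split /= exchange_big /= -[X in X + _]/(\sum_(k < size S) S`_k * F (k +
    0)%N u).
  have := SF u Iu; rewrite /poly_act => ->; rewrite add0r big1// => k _.
  have := Se k 0 (u - s); rewrite /poly_act => H.
  rewrite (eq_bigr (fun i : 'I_(size S) => - F k s * (S`_i * e k (i + 0)%N (u - s)))).
    by rewrite -mulr_sumr H mulr0.
  by move=> i _; ring.
- move=> i iN; rewrite /G subrr (bigD1 (Ordinal iN))//= e0// eqxx mulr1.
  rewrite big1 ?addr0 ?subrr// => k ki.
  rewrite e0// (_ : (i == k) = false) ?mulr0//.
  by apply/negbTE; apply: contraNneq ki => h; apply/eqP/val_inj.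
Qed.

End LinearODE.

(** * Primitives of integrable functions *)

Section Primitive.
Variable R : realType.
Notation mu := (@lebesgue_measure R).
Variables a b : R.
Hypothesis ab : a < b.
Notation I := `[a, b]%classic.
Implicit Types (f g h : R -> R) (t x : R).

Definition integrable_on (c d : R) g := mu.-integrable `[c, d] (EFin \o g).
Definition primitive (c : R) g t : R := \int[mu]_(s in `[c, t]) g s.

Lemma integrable_on_sub c d g : a <= c -> d <= b -> integrable_on a b g ->
  integrable_on c d g.
Proof.
move=> ac db; apply: integrableS => //.
by apply: subset_itvScc; rewrite bnd_simp.
Qed.

Lemma integrable_on_ext g h : (forall s, I s -> g s = h s) -> integrable_on a b g ->
  integrable_on a b h.
Proof. by move=> gh; apply: eq_integrable => // s /[!inE] Is /=; rewrite gh. Qed.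

Lemma integrable_onD g h : integrable_on a b g -> integrable_on a b h ->
  integrable_on a b (fun s => g s + h s).
Proof. by move=> ig ih; have := integrableD _ ig ih; apply. Qed.

Lemma integrable_onZ k g : integrable_on a b g -> integrable_on a b (fun s => k * g s).
Proof. by move=> ig; have := integrableZl _ k ig; apply. Qed.

Lemma integrable_on0 : integrable_on a b (fun=> 0).
Proof. exact: integrable0. Qed.

Lemma integrable_on_sum (K : Type) (r : seq K) (f : K -> R -> R) :
  (forall k, integrable_on a b (f k)) -> integrable_on a b (fun s => \sum_(k <- r) f k s).
Proof.
move=> fi; elim: r => [|k r IH].
  by apply: integrable_on_ext integrable_on0 => s _; rewrite big_nil.
by apply: integrable_on_ext (integrable_onD (fi k) IH) => s _; rewrite big_cons.
Qed.

Lemma integrable_on_norm g : integrable_on a b g -> integrable_on a b (fun s => `|g s|).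
Proof. exact: integrable_norm. Qed.

Lemma continuous_integrable_on f : {within I, continuous f} -> integrable_on a b f.
Proof. by move=> cf; apply: continuous_compact_integrable => //;
  exact: segment_compact. Qed.

Lemma integrable_on_cst k : integrable_on a b (fun=> k).
Proof.
apply: continuous_integrable_on; apply: continuous_subspaceT => x; exact: cst_continuous.
Qed.

Lemma continuous_measurable_itv f : {within I, continuous f} -> measurable_fun I f.
Proof. by move=> cf; apply: subspace_continuous_measurable_fun. Qed.

Lemma continuous_bounded f : {within I, continuous f} ->
  exists2 M, 0 <= M & forall s, I s -> `|f s| <= M.
Proof.
move=> cf; have /compact_bounded[M [_ mrt]] :=
  continuous_compact cf (segment_compact (a := a) (b := b)).
exists (`|M| + 1); first by rewrite addr_ge0.
move=> s Is; apply: (mrt (`|M| + 1)); last by exists s.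
by rewrite (le_lt_trans (ler_norm _))// ltrDl.
Qed.

Lemma integrable_onM f g : {within I, continuous f} -> integrable_on a b g ->
  integrable_on a b (fun s => f s * g s).
Proof.
move=> cf ig; have [M M0 Mf] := continuous_bounded cf.
have := @integrableMr _ _ _ mu I (measurable_itv _) f (EFin \o g)
  (continuous_measurable_itv cf) _ ig; apply.
exists M; split; rewrite ?num_real// => y My s Is /=.
by rewrite (le_trans (Mf _ Is))// ltW.
Qed.

Lemma ae_imp (P Q : R -> Prop) : (forall x, P x -> Q x) ->
  {ae mu, forall x, P x} -> {ae mu, forall x, Q x}.
Proof. by move=> PQ; apply: filterS => //; exact: (ae_filter_ringOfSetsType mu). Qed.

Lemma ae_and (P Q : R -> Prop) : {ae mu, forall x, P x} -> {ae mu, forall x, Q x} ->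
  {ae mu, forall x, P x /\ Q x}.
Proof. by move=> hP hQ; apply: filterI => //; exact: (ae_filter_ringOfSetsType mu). Qed.

Lemma ae_all (P : R -> Prop) : (forall x, P x) -> {ae mu, forall x, P x}.
Proof. by move=> HP; exists set0; split=> // x /(_ (HP x)). Qed.

Section PrimitiveTheory.
Variable g : R -> R.
Hypothesis ig : integrable_on a b g.

Lemma primitive0 : primitive a g a = 0.
Proof. by rewrite /primitive set_itv1 Rintegral_set1. Qed.

Lemma primitiveB t x : a <= t -> t <= x -> x <= b ->
  primitive a g x - primitive a g t = \int[mu]_(s in `]t, x]) g s.
Proof.
by move=> at_ tx xb; rewrite /primitive Rintegral_itvB//; apply: integrable_on_sub ig.
Qed.

Lemma primitiveZ k t : t <= b -> primitive a (fun s => k * g s) t = k * primitive a g t.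
Proof. by move=> tb; rewrite /primitive RintegralZl//; apply: integrable_on_sub ig. Qed.

Lemma primitiveD h t : integrable_on a b h -> t <= b ->
  primitive a (fun s => g s + h s) t = primitive a g t + primitive a h t.
Proof. by move=> ih tb; rewrite /primitive RintegralD//;
  apply: integrable_on_sub => //. Qed.

Lemma primitive_continuous : {within I, continuous (primitive a g)}.
Proof. by apply: parameterized_integral_continuous => //; exact: ltW. Qed.

End PrimitiveTheory.

Lemma primitive_sum (K : Type) (r : seq K) (f : K -> R -> R) t :
  (forall k, integrable_on a b (f k)) -> t <= b ->
  primitive a (fun s => \sum_(k <- r) f k s) t = \sum_(k <- r) primitive a (f k) t.
Proof.
move=> fi tb; elim: r => [|k r IH].
  rewrite big_nil /primitive (_ : (fun s => _) = fun s => 0 * (0 : R)).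
    by rewrite RintegralZl ?mul0r//; exact: integrable0.
  by apply/funext => s; rewrite big_nil mul0r.
rewrite big_cons -IH -primitiveD//; last exact: integrable_on_sum.
by congr primitive; apply/funext => s; rewrite big_cons.
Qed.

Lemma primitive_ext g h t : a <= t -> t <= b -> (forall s, I s -> g s = h s) ->
  primitive a g t = primitive a h t.
Proof.
move=> at_ tb gh; apply: eq_Rintegral => s /[!inE]; rewrite /= in_itv/= => /andP[as_ st].
by apply: gh; rewrite /= in_itv/= as_ (le_trans st).
Qed.

Lemma primitive_ae g h t : a <= t -> t <= b -> integrable_on a b g -> integrable_on a b h ->
  {ae mu, forall s, I s -> g s = h s} -> primitive a g t = primitive a h t.
Proof.
move=> at_ tb ig ih gh; rewrite /primitive /Rintegral; congr fine.
have sub s : `[a, t]%classic s -> I s.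
  by rewrite /= !in_itv/= => /andP[-> h'] /=; exact: le_trans tb.
apply: ae_eq_integral => //.
- by apply: measurable_int; apply: integrable_on_sub ig.
- by apply: measurable_int; apply: integrable_on_sub ih.
- by apply: ae_imp gh => s gh /sub /gh /= ->.
Qed.

Lemma primitive_bound_le g h (M : R) t x : integrable_on a b g ->
  integrable_on a b h -> 0 <= M ->
  a <= t -> t <= x -> x <= b ->
  (forall s, t <= s -> s <= x -> `|g s| <= M * `|h s|) ->
  `|primitive a g x - primitive a g t| <=
     M * `|primitive a (fun s => `|h s|) x - primitive a (fun s => `|h s|) t|.
Proof.
move=> ig ih M0 at_ tx xb gh.
have iG : mu.-integrable `]t, x] (EFin \o g).
  apply: integrableS ig => //; apply: subset_itv; rewrite bnd_simp//.
have iH : mu.-integrable `]t, x] (EFin \o (fun s => `|h s|)).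
  apply: integrableS (integrable_on_norm ih) => //; apply: subset_itv; rewrite bnd_simp//.
rewrite !primitiveB//; last exact: integrable_on_norm.
rewrite (le_trans (le_normr_Rintegral _ _))//.
rewrite [X in _ <= _ * X]ger0_norm; last by apply: Rintegral_ge0.
rewrite -RintegralZl//; apply: le_Rintegral => //.
- exact: integrable_norm.
- by have := integrableZl _ M iH; apply.
- by move=> s; rewrite /= in_itv/= => /andP[ts sx]; apply: gh => //; exact: ltW.
Qed.

(** The three-point form, with s between t and x whatever their order, allows bounds
that depend on the distances to t and x. *)
Lemma primitive_bound g h (M : R) t x : integrable_on a b g -> integrable_on a b h ->
  0 <= M ->
  I t -> I x ->
  (forall s, I s -> `|s - t| <= `|x - t| -> `|s - x| <= `|x - t| -> `|g s| <= M * `|h s|) ->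
  `|primitive a g x - primitive a g t| <=
     M * `|primitive a (fun s => `|h s|) x - primitive a (fun s => `|h s|) t|.
Proof.
move=> ig ih M0; rewrite /= !in_itv/= => /andP[at_ tb] /andP[ax xb] gh.
have [tx|xt] := leP t x.
  apply: primitive_bound_le => // s ts sx; apply: gh.
  - by rewrite in_itv/= (le_trans at_ ts) (le_trans sx xb).
  - by rewrite !ger0_norm ?subr_ge0// lerD2r.
  - by rewrite distrC !ger0_norm ?subr_ge0// lerD2l lerN2.
rewrite distrC [X in _ <= _ * X]distrC.
apply: primitive_bound_le => //; [exact: ltW|] => s xs st; apply: gh.
- by rewrite in_itv/= (le_trans ax xs) (le_trans st tb).
- by rewrite distrC [leRHS]distrC !ger0_norm ?subr_ge0 ?(ltW xt)// lerD2l lerN2.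
- by rewrite [leRHS]distrC !ger0_norm ?subr_ge0 ?(ltW xt)// lerD2r.
Qed.

Lemma primitive_cst k t : a <= t -> primitive a (fun=> k) t = k * (t - a).
Proof.
move=> at_; rewrite /primitive Rintegral_cst//.
transitivity (k * fine (mu `[a, t]%classic)) => //.
rewrite lebesgue_measure_itv/= lte_fin.
by case: ltP => // ta; have -> : t = a by [apply/le_anti/andP]; rewrite /= subrr.
Qed.

Lemma primitive_has_deriv f t : {within I, continuous f} -> I t ->
  has_deriv I (primitive a f) t (f t).
Proof.
move=> cf It e e0.
have ct : f x @[x --> within I (nbhs t)] --> f t by move/subspace_continuousP : cf; exact.
have /cvgrPdist_lt/(_ e e0) H := ct.
have {}H : \forall x \near t, I x -> `|f t - f x| < e by [].
have /nbhs_ballP[d /= d0 Hd] := H.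
have if_ := continuous_integrable_on cf.
have ic k : integrable_on a b (fun=> k) by exact: integrable_on_cst.
near=> x => Ix.
have xd : `|x - t| < d.
  by rewrite distrC; near: x; apply/nbhs_ballP; exists d.
have [tb xb] : t <= b /\ x <= b by move: It Ix;
  rewrite /= !in_itv/= => /andP[_ ->] /andP[_ ->].
have [at_ ax] : a <= t /\ a <= x by move: It Ix;
  rewrite /= !in_itv/= => /andP[-> _] /andP[-> _].
have E y : a <= y -> y <= b ->
  primitive a (fun s => f s + - f t) y = primitive a f y - f t * (y - a).
  by move=> ay yb; rewrite (primitiveD if_ (ic _))// primitive_cst// mulNr.
have -> : primitive a f x - primitive a f t - f t * (x - t) =
   primitive a (fun s => f s + - f t) x - primitive a (fun s => f s + - f t) t.
  by rewrite !E//; ring.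
rewrite (le_trans (@primitive_bound _ (fun=> 1) e _ _ _ _ _ _ _ _))//.
- by apply: integrable_onD.
- exact: ltW.
- move=> s Is st _; rewrite normr1 mulr1 distrC ltW//; apply: Hd => //.
  by rewrite /ball /= distrC (le_lt_trans st).
- rewrite normr1 !primitive_cst// !mul1r.
  by rewrite (_ : x - a - (t - a) = x - t)//; ring.
Unshelve. all: by end_near. Qed.

Lemma FTC2_has_deriv (F f : R -> R) : {within I, continuous f} ->
  (forall t, I t -> has_deriv I F t (f t)) ->
  forall t, I t -> F t = F a + primitive a f t.
Proof.
move=> cf dF t It; apply/eqP; rewrite -subr_eq0; apply/eqP.
have Ia : I a by rewrite /= in_itv/= lexx ltW.
apply: (@gronwall _ unit (fun _ t => F t - (F a + primitive a f t)) (fun=> fun=> 0) a b 0 a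
   (lexx _) Ia _ _ _ tt) => //.
- move=> _ x Ix; have -> : 0 = f x + - 1 * (0 + f x) by ring.
  apply: (@has_deriv_eq _ _ (fun t => F t + - 1 * (F a + primitive a f t))) => //.
    by move=> y _; rewrite mulN1r.
  apply: has_derivD; first exact: dF.
  apply: has_derivZ; apply: has_derivD; first exact: has_deriv_cst.
  exact: primitive_has_deriv.
- by move=> _ x _; rewrite normr0 mul0r.
- by move=> _; rewrite (primitive0 f) addr0 subrr.
Qed.

(** Lebesgue's differentiation theorem for the extension of g by zero. *)
Lemma primitive_ae_has_deriv g : integrable_on a b g ->
  {ae mu, forall t, I t -> has_deriv I (primitive a g) t (g t)}.
Proof.
move=> ig.
have iT : mu.-integrable setT (EFin \o (g \_ I)).
  rewrite -restrict_EFin; apply/integrable_restrict => //; rewrite setTI//.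
have := @FTC1Ny R (g \_ I) _ (integrable_locally (measurable_itv _) ig).
move=> /(_ _); case.
  by move=> y; apply: integrableS iT.
move=> N [mN N0 NH]; exists N; split=> // x /= Hx; apply: NH => /= -[dF F'].
apply: Hx => Ix.
have dF' : is_derive x 1 (fun x => \int[mu]_(t in [set` `]-oo, x]]) (g \_ I) t) (g x).
  split; first exact: dF.
  by rewrite -derive1E F' patchE mem_set.
apply: has_deriv_eq (has_deriv_is_derive I dF') => // y /[!inE] Iy.
rewrite -Rintegral_mkcondr /primitive; congr (Rintegral _ _ _).
apply/seteqP; split => z /=; rewrite !in_itv/=.
  by move=> [zy /andP[-> _]].
move=> /andP[az zy]; split=> //; rewrite az/= (le_trans zy)//.
by move: Iy; rewrite /= in_itv/= => /andP[].
Qed.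

(** Product rule for sum_k f_k H_k, where H_k is a primitive of kap_k h and need
not be differentiable at every point.  The increments of the
H_k contribute the integral of (sum_k f_k(x) kap_k(s)) h(s) between t and x; the
hypothesis on the diagonal values of this kernel makes it differ from c by
O(|x - t|), so that only c h survives, and it is subtracted. *)
Lemma variation_of_constants (K : finType) (f f' kap : K -> R -> R) (h : R -> R) (c : R) :
  (forall k (t : R), is_derive t (1 : R) (f k) (f' k t)) ->
  (forall k, {within I, continuous (f' k)}) ->
  (forall k, {within I, continuous (kap k)}) ->
  (forall t, I t -> \sum_k f k t * kap k t = c) ->
  integrable_on a b h ->
  let H k t := primitive a (fun s => kap k s * h s) t in
  (forall t, I t -> has_deriv I (fun x => \sum_k f k x * H k x - c * primitive a h x) t
                     (\sum_k f' k t * H k t)).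
Proof.
move=> df cf' ckap fk ih H t It.
have ikh k : integrable_on a b (fun s => kap k s * h s) by exact: integrable_onM.
have /choice[B HB] : forall k, exists B, 0 <= B /\ forall s, I s -> `|f' k s| <= B.
  by move=> k; have [B B0 HB] := continuous_bounded (cf' k); exists B.
have /choice[M HM] : forall k, exists B, 0 <= B /\ forall s, I s -> `|kap k s| <= B.
  by move=> k; have [B' B0 HB'] := continuous_bounded (ckap k); exists B'.
have lipf k x s : I x -> I s -> `|f k x - f k s| <= B k * `|x - s|.
  move=> Ix Is.
  have dfk y : I y -> has_deriv I (f k) y (f' k y) by move=> _; exact: has_deriv_is_derive.
  have E y : I y -> f k y = f k a + primitive a (f' k) y.
    by move=> Iy; exact: (FTC2_has_deriv (cf' k) dfk).
  have ic : integrable_on a b (fun=> 1) by exact: integrable_on_cst.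
  rewrite (E x)// (E s)// opprD addrACA subrr add0r.
  rewrite (le_trans (@primitive_bound _ (fun=> 1) (B k) _ _ _ _ _ _ _ _))//.
  - exact: continuous_integrable_on.
  - by have [] := HB k.
  - by move=> y Iy _ _; rewrite normr1 mulr1; have [_] := HB k; apply.
  - rewrite normr1; move: Ix Is; rewrite /= !in_itv/= => /andP[ax _] /andP[as_ _].
    rewrite !primitive_cst// !mul1r.
    by rewrite (_ : x - a - (s - a) = x - s)//; ring.
pose C := \sum_k B k * M k.
have C0 : 0 <= C.
  by rewrite sumr_ge0// => k _; rewrite mulr_ge0//; [have [] := HB k|have [] := HM k].
have d1 : has_deriv I (fun x => \sum_k H k t * f k x) t (\sum_k H k t * f' k t).
  by apply: has_deriv_sum => k _; apply: has_derivZ; exact: has_deriv_is_derive.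
move=> e e0.
pose e2 := e / 2.
have e20 : 0 < e2 by rewrite divr_gt0.
have eC : 0 < e2 / (C + 1) by rewrite divr_gt0// ltr_wpDl.
have inh := integrable_on_norm ih.
have cA : primitive a (fun s => `|h s|) x @[x --> within I (nbhs t)]
    --> primitive a (fun s => `|h s|) t.
  by move/subspace_continuousP : (primitive_continuous inh); exact.
have HA : \forall x \near t, I x ->
   `|primitive a (fun s => `|h s|) t - primitive a (fun s => `|h s|) x| <= e2 / (C + 1).
  by move/cvgrPdist_le : cA => /(_ _ eC).
have Hd1 := d1 _ e20.
near=> x => Ix.
have tb : t <= b by move: It; rewrite /= in_itv/= => /andP[].
have xb : x <= b by move: Ix; rewrite /= in_itv/= => /andP[].
(* The increments of the H k and of c * primitive a h form one integral, of the
   kernel sum_k (f k x - f k s) kap k s by the diagonal hypothesis. *)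
pose G s := \sum_k f k x * (kap k s * h s) + - c * h s.
have iG : integrable_on a b G.
  apply: integrable_onD; last exact: integrable_onZ.
  by apply: integrable_on_sum => k; exact: integrable_onZ.
have GE y : y <= b -> primitive a G y = \sum_k f k x * H k y - c * primitive a h y.
  move=> yb; rewrite primitiveD//; last exact: integrable_onZ; last first.
    by apply: integrable_on_sum => k; exact: integrable_onZ.
  rewrite primitiveZ// mulNr; congr (_ - _).
  rewrite primitive_sum//; last by move=> k; exact: integrable_onZ.
  by apply: eq_bigr => k _; rewrite primitiveZ.
have G1 : `|primitive a G x - primitive a G t| <= e2 * `|x - t|.
  rewrite (le_trans (@primitive_bound _ h (C * `|x - t|) t x _ _ _ _ _ _))//.
  - by rewrite mulr_ge0.
  - move=> s Is _ sx.
    have -> : G s = (\sum_k (f k x - f k s) * kap k s) * h s.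
      rewrite /G -(fk s Is) -sumrN !mulr_suml -big_split /=.
      by apply: eq_bigr => k _; ring.
    rewrite normrM ler_wpM2r// (le_trans (ler_norm_sum _ _ _))// mulr_suml.
    apply: ler_sum => k _; rewrite normrM mulrAC ler_pM//; last by have [_] := HM k; apply.
    rewrite (le_trans (lipf k _ _ Ix Is))// ler_wpM2l//; first by have [] := HB k.
    by rewrite distrC.
  - have Hx : `|primitive a (fun s => `|h s|) x - primitive a (fun s =>
    `|h s|) t| <= e2 / (C + 1).
      by rewrite distrC; move: Ix; near: x.
    rewrite mulrAC ler_wpM2r// (le_trans (ler_wpM2l C0 Hx))//.
    by rewrite mulrCA ler_piMr ?(ltW e20)// ler_pdivrMr ?ltr_wpDl// mul1r lerDl.
have D1 : `|\sum_k H k t * f k x - \sum_k H k t * f k t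
     - (\sum_k H k t * f' k t) * (x - t)| <= e2 * `|x - t|.
  by move: Ix; near: x; exact: Hd1.
have -> : \sum_k f k x * H k x - c * primitive a h x -
     (\sum_k f k t * H k t - c * primitive a h t) - (\sum_k f' k t * H k t) * (x - t)
  = (primitive a G x - primitive a G t) + (\sum_k H k t * f k x - \sum_k H k t * f k t
     - (\sum_k H k t * f' k t) * (x - t)).
  rewrite !GE//.
  have S1 : \sum_k f k t * H k t = \sum_k H k t * f k t by apply: eq_bigr => k _;
    rewrite mulrC.
  have S2 : \sum_k f' k t * H k t = \sum_k H k t * f' k t by apply: eq_bigr => k _;
    rewrite mulrC.
  have S3 : \sum_k f k x * H k t = \sum_k H k t * f k x by apply: eq_bigr => k _;
    rewrite mulrC.
  by rewrite S1 S2 S3; ring.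
rewrite (le_trans (ler_normD _ _))//.
by rewrite [e]splitr mulrDl lerD.
Unshelve. all: by end_near. Qed.

End Primitive.

(** * Continuity on an interval *)

Section WithinContinuity.
Variable R : realType.
Variables a b : R.
Notation I := `[a, b]%classic.
Implicit Types f g : R -> R.

Lemma within_contP f : {within I, continuous f} <->
  forall t, I t -> f x @[x --> within I (nbhs t)] --> f t.
Proof. exact: subspace_continuousP. Qed.

Lemma within_contD f g : {within I, continuous f} -> {within I, continuous g} ->
  {within I, continuous (fun x => f x + g x)}.
Proof.
move=> /within_contP cf /within_contP cg; apply/within_contP => t It.
by apply: cvgD; [exact: cf|exact: cg].
Qed.

Lemma within_contZ k f : {within I, continuous f} ->
  {within I, continuous (fun x => k * f x)}.
Proof.
move=> /within_contP cf; apply/within_contP => t It.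
by apply: cvgM; [exact: cvg_cst|exact: cf].
Qed.

Lemma within_cont_cst k : {within I, continuous (fun=> k : R)}.
Proof. by apply: continuous_subspaceT => x; exact: cst_continuous. Qed.

Lemma within_cont_sum (K : Type) (r : seq K) (f : K -> R -> R) :
  (forall k, {within I, continuous (f k)}) ->
  {within I, continuous (fun x => \sum_(k <- r) f k x)}.
Proof.
move=> cf; elim: r => [|k r IH].
  rewrite (_ : (fun x => _) = fun=> 0); first exact: within_cont_cst.
  by apply/funext => x; rewrite big_nil.
rewrite (_ : (fun x => _) = fun x => f k x + \sum_(k <- r) f k x).
  exact: within_contD.
by apply/funext => x; rewrite big_cons.
Qed.

Lemma within_cont_ext f g : {in I, f =1 g} -> {within I, continuous f} ->
  {within I, continuous g}.
Proof. by move=> fg; apply: subspace_eq_continuous. Qed.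

Lemma is_derive_within_cont f f' : (forall t : R, is_derive t (1 : R) f (f' t)) ->
  {within I, continuous f}.
Proof.
move=> df; apply: (@has_deriv_continuous_itv _ _ _ _ f') => t _.
exact: has_deriv_is_derive.
Qed.

End WithinContinuity.

(** * Reflection and Lebesgue measure *)

Section Reflection.
Variable R : realType.
Notation mu := (@lebesgue_measure R).
Variable T : R.
Notation I := `[- T, T]%classic.

Lemma within_cont_opp f : {within I, continuous f} ->
  {within I, continuous (fun x => f (- x) : R)}.
Proof.
move=> /within_contP cf; apply/within_contP => t It.
have It' : I (- t) by exact: sym_itv.
have H := cf _ It'.
apply: (@cvg_comp _ _ _ (fun x => - x) f _ (within I (nbhs (- t)))) => //.
move=> P HP; have {}HP : \forall x \near (- t), I x -> P x by [].
suff : \forall x \near t, I x -> P (- x) by [].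
have : \forall x \near t, I (- x) -> P (- x).
  by have := @oppr_continuous _ _ t; rewrite /continuous_at => /(_ _ HP).
by apply: filterS => x Px Ix; apply: Px; exact: sym_itv.
Qed.

Lemma ae_opp (P : R -> Prop) : {ae mu, forall x, P x} -> {ae mu, forall x, P (- x)}.
Proof.
move=> [N [mN N0 NP]].
have mN' : measurable ((-%R : _ -> measurableTypeR R) @^-1` N).
  rewrite -[X in measurable X]setTI.
  by apply: (@oppr_measurable R setT) => //.
exists ((-%R : _ -> measurableTypeR R) @^-1` N); split=> //.
- by have := lebesgue_measureN mN; rewrite /pushforward N0.
- by move=> x /= Px; apply: NP.
Qed.

Variable g : R -> R.
Hypothesis ig : integrable_on (- T) T g.

Let mgI : measurable_fun [set: R] (EFin \o (g \_ I)).
Proof.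
apply/measurable_EFinP; apply/(measurable_restrictT _ _).1 => //.
by apply/measurable_EFinP; exact: measurable_int ig.
Qed.

Let igI : mu.-integrable setT (EFin \o (g \_ I)).
Proof. by rewrite -restrict_EFin; apply/integrable_restrict => //; rewrite setTI. Qed.

Let igIN : mu.-integrable setT ((EFin \o (g \_ I)) \o -%R).
Proof.
have mN : measurable_fun [set: measurableTypeR R] (-%R : _ -> measurableTypeR R).
  exact: oppr_measurable.
apply/integrableP; split.
  exact: (measurableT_comp mgI mN).
have /integrableP[_] := igI.
have -> : (\int[mu]_x `|(EFin \o g \_ I) x| =
          \int[pushforward mu (-%R : _ -> measurableTypeR R)]_x `|(EFin \o g \_ I) x|)%E.
  by apply: eq_measure_integral => A mA _; exact/esym/lebesgue_measureN.
rewrite ge0_integral_pushforward//.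
exact: (measurableT_comp (@abse_measurable R setT) mgI).
Qed.

(** Lebesgue measure is invariant under the reflection. *)
Lemma integrable_on_opp : integrable_on (- T) T (fun s => g (- s)).
Proof.
have : mu.-integrable I ((EFin \o (g \_ I)) \o -%R) by apply: integrableS igIN.
apply: eq_integrable => // s /[!inE] Is /=.
by rewrite patchE mem_set//; exact: sym_itv.
Qed.

Lemma primitive_opp t : I t ->
  primitive (- T) (fun s => g (- s)) t = primitive (- T) g T - primitive (- T) g (- t).
Proof.
move=> It; have [l r] : - T <= t /\ t <= T by move: It; rewrite /= in_itv/= => /andP.
rewrite (primitiveB ig) ?lerN2//; last by rewrite lerNl.
rewrite Rintegral_itv_obnd_cbnd; last first.
  by apply: integrableS ig => //; apply: subset_itv; rewrite bnd_simp// lerNr opprK.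
rewrite /primitive /Rintegral; congr fine.
transitivity (\int[mu]_(x in -%R @^-1` `[(- t)%R, T]) ((EFin \o (g \_ I)) \o -%R) x)%E.
  have -> : (-%R @^-1` `[- t, T])%classic = `[- T, t]%classic.
    by apply/seteqP; split => x /=; rewrite !in_itv/= lerN2 lerNl andbC.
  apply: eq_integral => s /[!inE]; rewrite /= in_itv/= => /andP[s1 s2].
  rewrite patchE mem_set//; apply: sym_itv.
  by rewrite /= in_itv/= s1 (le_trans s2).
have mN : measurable_fun [set: measurableTypeR R] (-%R : _ -> measurableTypeR R).
  exact: oppr_measurable.
have iN : mu.-integrable (-%R @^-1` `[- t, T]%classic) ((EFin \o (g \_ I)) \o -%R).
  apply: integrableS igIN => //.
  by rewrite -[X in measurable X]setTI; apply: (@oppr_measurable R setT).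
rewrite -(integral_pushforward mN mgI iN)//.
transitivity (\int[mu]_(x in `[(- t)%R, T]) (EFin \o (g \_ I)) x)%E.
  by apply: eq_measure_integral => A mA _; exact: lebesgue_measureN.
apply: eq_integral => s /[!inE]; rewrite /= in_itv/= => /andP[s1 s2].
rewrite patchE mem_set//= in_itv/= s2 andbT (le_trans _ s1)// lerN2//.
Qed.

End Reflection.

(** * Sobolev jets *)

Section Sobolev.
Variable R : realType.
Notation mu := (@lebesgue_measure R).
Variables a b : R.
Hypothesis ab : a < b.
Notation I := `[a, b]%classic.
Variable n : nat.
Hypothesis n0 : (0 < n)%N.
Implicit Types (F G : nat -> R -> R).

(** Jets of functions in W^{n,1}: the last entry F n is a density of the absolutely
continuous F n.-1, not a derivative at every point. *)
Definition sobolev F :=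
  [/\ forall j t, (j.+1 < n)%N -> I t -> has_deriv I (F j) t (F j.+1 t),
      integrable_on a b (F n) &
      forall t, I t -> F n.-1 t = F n.-1 a + primitive a (F n) t].

Let Ia : I a. Proof. by rewrite /= in_itv/= lexx ltW. Qed.

Lemma sobolevD F G : sobolev F -> sobolev G -> sobolev (jet_add F G).
Proof.
move=> [dF iF pF] [dG iG pG]; split.
- by move=> j t jn It; apply: has_derivD; [exact: dF|exact: dG].
- exact: integrable_onD.
- move=> t It; rewrite /jet_add (primitiveD iF iG)//; last by move: It;
  rewrite /= in_itv/= => /andP[].
  by rewrite pF// pG//; ring.
Qed.

Lemma sobolevZ k F : sobolev F -> sobolev (fun j t => k * F j t).
Proof.
move=> [dF iF pF]; split.
- by move=> j t jn It; apply: has_derivZ; exact: dF.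
- exact: integrable_onZ.
- move=> t It; rewrite (primitiveZ iF)//; last by move: It; rewrite /= in_itv/= => /andP[].
  by rewrite pF//; ring.
Qed.

Lemma smooth_sobolev F : (forall j t, I t -> has_deriv I (F j) t (F j.+1 t)) -> sobolev F.
Proof.
move=> dF; have cF j : {within I, continuous (F j)}.
  by apply: (@has_deriv_continuous_itv _ _ _ _ (F j.+1)) => t; exact: dF.
split; first by move=> j t _; exact: dF.
- exact: continuous_integrable_on.
- apply: FTC2_has_deriv => // t It; rewrite -[in F n](prednK n0); exact: dF.
Qed.

Lemma sobolev_cont F j : sobolev F -> (j < n)%N -> {within I, continuous (F j)}.
Proof.
move=> [dF iF pF] jn.
have [jn1|nj] := ltnP j.+1 n.
  by apply: (@has_deriv_continuous_itv _ _ _ _ (F j.+1)) => t It; exact: dF.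
have -> : j = n.-1 by lia.
apply: (@within_cont_ext _ _ _ (fun t => F n.-1 a + primitive a (F n) t)).
  by move=> t /set_mem It; rewrite (pF t It).
by apply: within_contD; [exact: within_cont_cst|exact: primitive_continuous].
Qed.

Lemma sobolev_ae_deriv F : sobolev F ->
  {ae mu, forall t, I t -> has_deriv I (F n.-1) t (F n t)}.
Proof.
move=> [dF iF pF]; have := primitive_ae_has_deriv iF; apply: ae_imp => t H It.
apply: (@has_deriv_eq _ _ (fun t => F n.-1 a + primitive a (F n) t)) => //.
  by move=> x /set_mem Ix; rewrite (pF x Ix).
by rewrite -[F n t]add0r; apply: has_derivD; [exact: has_deriv_cst|exact: H].
Qed.

Lemma sobolev_jet v F : sobolev F -> (forall t, I t -> v t = F 0 t) -> jet_of I I n.-1 v F.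
Proof.
move=> [dF iF pF] vF; apply: jet_intro => //; first exact: relopen_refl.
by move=> j t jn It; apply: dF => //; rewrite -ltn_predRL.
Qed.

Lemma sobolev_Wn1 v F : sobolev F -> (forall t, I t -> v t = F 0 t) -> Wn1 a b n v.
Proof.
move=> sF vF; have [d jv] := sobolev_jet sF vF; split=> //.
case: (sF) => dF iF pF; exists (F n) => // t It.
by rewrite !jv// pF.
Qed.

(** The iterated derivative of order n is only known to exist where F n.-1 is
differentiable. *)
Lemma sobolev_ae_derivn v F : sobolev F -> (forall t, I t -> v t = F 0 t) ->
  {ae mu, forall t, I t -> derivn_in I n v t = F n t}.
Proof.
move=> sF vF; have [d jv] := sobolev_jet sF vF.
have := sobolev_ae_deriv sF; apply: ae_imp => t H It.
rewrite -[in derivn_in _ n](prednK n0).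
have [_ Hd] := has_deriv_deriv_in ab It (H It).
rewrite -Hd; rewrite /derivn_in iterS -/(derivn_in _ _ _).
have H' : has_deriv I (derivn_in I n.-1 v) t (F n t).
  apply: has_deriv_eq (H It) => // x /[!inE] Ix; by rewrite jv.
by have [_ ->] := has_deriv_deriv_in ab It H'.
Qed.

Lemma Wn1_sobolev v : Wn1 a b n v -> exists2 F, sobolev F & forall t, I t -> v t = F 0 t.
Proof.
move=> [dv [g ig gv]].
exists (fun j => if (j < n)%N then derivn_in I j v else g); last first.
  by move=> t It; rewrite n0.
split.
- move=> j t jn It; rewrite jn (ltnW jn).
  by apply: (nderivable_has_deriv dv) => //; rewrite ltn_predRL.
- by rewrite ltnn.
- by move=> t It; rewrite prednK// leqnn ltnn; exact: gv.
Qed.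

Lemma sobolev_jet_lt v F j t : sobolev F -> (forall t, I t -> v t = F 0 t) ->
  (j < n)%N -> I t -> derivn_in I j v t = F j t.
Proof.
move=> sF vF jn It; have [_ H] := sobolev_jet sF vF; apply: H => //.
by rewrite -ltnS prednK.
Qed.

End Sobolev.

(** * Reflection problems in terms of jets *)

Section ReflectionProblem.
Variable R : realType.
Notation mu := (@lebesgue_measure R).
Variable T : R.
Hypothesis T0 : 0 < T.
Notation I := `[- T, T]%classic.
Variable n : nat.
Hypothesis n0 : (0 < n)%N.
Variable L : reflop R.
Let p := refl_part L.
Let q := diff_part L.
Hypothesis szp : (size p <= n.+1)%N.
Hypothesis szq : (size q <= n.+1)%N.
Variables alpha beta : 'M[R]_n.
Let TT := oppT_lt T0.
Implicit Types (F G : nat -> R -> R).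

Definition jet_bform (i : 'I_n) F : R :=
  \sum_(j < n) (alpha i j * F j (- T) + beta i j * F j T).

Let IT : I T. Proof. by rewrite /= in_itv/= lexx ltW. Qed.
Let INT : I (- T). Proof. by rewrite /= in_itv/= lexx ltW. Qed.

Lemma bform_jet_bform i u F :
  (forall j, (j < n)%N -> derivn_in I j u (- T) = F j (- T)) ->
  (forall j, (j < n)%N -> derivn_in I j u T = F j T) ->
  bform T alpha beta i u = jet_bform i F.
Proof. by move=> h1 h2; apply: eq_bigr => j _; rewrite h1// h2. Qed.

(** The order n derivative is taken at t and at - t, and the reflection preserves
null sets. *)
Lemma apply_op_ae v F : sobolev (- T) T n F -> (forall t, I t -> v t = F 0 t) ->
  {ae mu, forall t, I t -> apply_op I L v t = op_act L F 0 t}.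
Proof.
move=> sF vF; have H := sobolev_ae_derivn TT n0 sF vF.
have := ae_and H (ae_opp H); apply: ae_imp => t [H1 H2] It.
have D k x : (k < n.+1)%N -> I x -> (I x -> derivn_in I n v x = F n x) ->
    derivn_in I k v x = F k x.
  rewrite ltnS leq_eqVlt => /predU1P[-> Ix|kn Ix _]; first exact.
  exact: (sobolev_jet_lt TT n0 sF).
rewrite /apply_op /pullback /diffop /op_act /jet_add /jet_refl /poly_act mul1r;
  congr (_ + _).
  apply: eq_bigr => k _; rewrite addn0 D//; last exact: sym_itv.
  exact: (leq_trans (ltn_ord k)).
by apply: eq_bigr => k _; rewrite addn0 D//; exact: (leq_trans (ltn_ord k)).
Qed.

Lemma sobolev_solves h v F : sobolev (- T) T n F -> (forall t, I t -> v t = F 0 t) ->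
  {ae mu, forall t, I t -> op_act L F 0 t = h t} -> (forall i, jet_bform i F = 0) ->
  solves_problem T L alpha beta h v.
Proof.
move=> sF vF LF BF; split; first exact: (sobolev_Wn1 TT sF).
  have := ae_and LF (apply_op_ae sF vF); apply: ae_imp => t [H1 H2] It.
  by rewrite H2// H1.
by move=> i; rewrite (@bform_jet_bform _ _ F)// => j jn; apply: (sobolev_jet_lt TT n0 sF).
Qed.

Lemma solves_sobolev h v : solves_problem T L alpha beta h v -> exists F,
  [/\ sobolev (- T) T n F, forall t, I t -> v t = F 0 t,
      {ae mu, forall t, I t -> op_act L F 0 t = h t} & forall i, jet_bform i F = 0].
Proof.
move=> [Wv Lv Bv]; have [F sF vF] := Wn1_sobolev n0 Wv; exists F; split=> //.
  have := ae_and Lv (apply_op_ae sF vF); apply: ae_imp => t [H1 H2] It.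
  by rewrite -H2// H1.
by move=> i; rewrite -(Bv i) (@bform_jet_bform _ _ F)// => j jn;
  apply: (sobolev_jet_lt TT n0 sF).
Qed.

Lemma coef_reduced_poly_top :
  (reduced_poly L)`_(n + n) = (-1) ^+ n * (p`_n ^+ 2 - q`_n ^+ 2).
Proof.
have H (c d : {poly R}) : (size c <= n.+1)%N -> (size d <= n.+1)%N ->
    (c * d)`_(n + n) = c`_n * d`_n.
  move=> hc hd; rewrite coefM.
  have nn : (n < (n + n).+1)%N by rewrite ltnS leq_addr.
  rewrite (bigD1 (Ordinal nn)) //= addKn big1 ?addr0// => i ni.
  have : (i != n :> nat) by apply: contraNneq ni => ni; apply/eqP/val_inj.
  rewrite neq_ltn => /orP[i_n|ni'].
    rewrite [d`_ _]nth_default ?mulr0// (leq_trans hd)//.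
    by rewrite ltn_subRL addnC ltn_add2l.
  by rewrite [c`_ _]nth_default ?mul0r// (leq_trans hc).
rewrite /reduced_poly coefB !H ?poly_refl_coef ?(leq_trans (size_poly_refl _))//.
by rewrite -/p -/q; ring.
Qed.

Hypothesis szS : size (reduced_poly L) = (n + n).+1.

(** The leading coefficient of S is, up to sign, the determinant of the system formed
by the highest order terms of L at t and at - t. *)
Lemma det_neq0 : q`_n ^+ 2 - p`_n ^+ 2 != 0.
Proof.
have : (reduced_poly L)`_(n + n) != 0.
  have <- : (size (reduced_poly L)).-1 = (n + n)%N by rewrite szS.
  by rewrite -lead_coefE lead_coef_eq0 -size_poly_gt0 szS.
rewrite coef_reduced_poly_top mulf_eq0 negb_or => /andP[_].
by rewrite -opprB oppr_eq0.
Qed.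

(** The values L F(t) = 0 and L F(- t) = 0 determine F n t through lower
derivatives at t and - t, for almost every t; since these are continuous, F n.-1
is continuously differentiable and the functions F j t, F j (- t), j < n, solve a
linear system, whose data at t = 0 vanish. *)
Lemma reflop_uniq F : sobolev (- T) T n F ->
  {ae mu, forall t, I t -> op_act L F 0 t = 0} ->
  (forall j, (j < n)%N -> F j 0 = 0) ->
  forall j t, (j < n)%N -> I t -> F j t = 0.
Proof.
move=> sF LF F0; case: (sF) => dF iF pF.
have D0 := det_neq0; set D := q`_n ^+ 2 - p`_n ^+ 2 in D0.
pose rho t := \sum_(k < n) (p`_k * F k (- t) + q`_k * F k t).
pose Phi t := (p`_n / D) * rho (- t) + (- q`_n / D) * rho t.
have crho : {within I, continuous rho}.
  apply: within_cont_sum => k; apply: within_contD; apply: within_contZ.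
    by apply: within_cont_opp => //; apply: (sobolev_cont TT n0 sF).
  by apply: (sobolev_cont TT n0 sF).
have cPhi : {within I, continuous Phi}.
  by apply: within_contD; apply: within_contZ => //; apply: within_cont_opp.
(* Cramer's rule for the unknowns F n t and F n (- t). *)
have FPhi : {ae mu, forall t, I t -> F n t = Phi t}.
  have := ae_and LF (ae_opp LF); apply: ae_imp => t [H1 H2] It.
  have {}H1 := H1 It; have {}H2 := H2 (sym_itv It).
  move: H1 H2; rewrite !(op_actE _ _ _ szp szq) !big_ord_recr /= !addn0.
  set A1 := \sum_(k < n) _; set A2 := \sum_(k < n) _.
  have -> : A1 = rho t by apply: eq_bigr => k _; rewrite addn0 mul1r.
  have -> : A2 = rho (- t) by apply: eq_bigr => k _; rewrite addn0 mul1r.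
  rewrite opprK !mul1r -/p -/q => H1 H2; rewrite /Phi.
  apply: (mulfI D0).
  have -> : D * (p`_n / D * rho (- t) + - q`_n / D * rho t)
      = p`_n * rho (- t) - q`_n * rho t by field.
  rewrite /D; apply/eqP; rewrite -subr_eq0; apply/eqP.
  have -> : (q`_n ^+ 2 - p`_n ^+ 2) * F n t - (p`_n * rho (- t) - q`_n * rho t)
    = q`_n * (rho t + (p`_n * F n (- t) + q`_n * F n t)) -
      p`_n * (rho (- t) + (p`_n * F n t + q`_n * F n (- t))) by ring.
  by rewrite H1 H2 !mulr0 subrr.
have dlast t : I t -> has_deriv I (F n.-1) t (Phi t).
  move=> It.
  apply: (@has_deriv_eq _ _ (fun t => F n.-1 (- T) + primitive (- T) Phi t)) => //.
    move=> x /[!inE] Ix; have [l r] : - T <= x /\ x <= T.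
      by move: Ix; rewrite /= in_itv/= => /andP.
    rewrite (pF x Ix); congr (_ + _); apply/esym.
    exact: (primitive_ae l r iF (continuous_integrable_on cPhi) FPhi).
  rewrite -[Phi t]add0r; apply: has_derivD; first exact: has_deriv_cst.
  exact: primitive_has_deriv.
pose F' (k : nat) t := if (k.+1 < n)%N then F k.+1 t else Phi t.
have dF' (k : 'I_n) t : I t -> has_deriv I (F k) t (F' k t).
  move=> It; rewrite /F'; case: ltnP => kn; first exact: dF.
  have -> : k = n.-1 :> nat by have := ltn_ord k; lia.
  exact: dlast.
pose f (kb : 'I_n * bool) t := F kb.1 (if kb.2 then - t else t).
pose f' (kb : 'I_n * bool) t := if kb.2 then - F' kb.1 (- t) else F' kb.1 t.
pose Nm t := \sum_kb `|f kb t|.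
have NmE kb t : `|f kb t| <= Nm t by rewrite /Nm (bigD1 kb)//= lerDl sumr_ge0.
have NmF (k : 'I_n) t : `|F k t| <= Nm t by exact: (NmE (k, false) t).
have NmFN (k : 'I_n) t : `|F k (- t)| <= Nm t by exact: (NmE (k, true) t).
have Nm0 t : 0 <= Nm t by rewrite sumr_ge0.
pose A := \sum_(k < n) (`|p`_k| + `|q`_k|).
have A0 : 0 <= A by rewrite sumr_ge0// => k _; rewrite addr_ge0.
have rhob t : `|rho t| <= A * Nm t.
  rewrite (le_trans (ler_norm_sum _ _ _))// mulr_suml; apply: ler_sum => k _.
  rewrite (le_trans (ler_normD _ _))// mulrDl !normrM lerD// ler_wpM2l//.
have rhobN t : `|rho (- t)| <= A * Nm t.
  rewrite (le_trans (ler_norm_sum _ _ _))// mulr_suml; apply: ler_sum => k _.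
  by rewrite (le_trans (ler_normD _ _))// opprK mulrDl !normrM lerD// ler_wpM2l.
pose C := 1 + (`|p`_n / D| * A + `|- q`_n / D| * A).
have C1 : 1 <= C by rewrite lerDl addr_ge0// mulr_ge0.
have Phib t : `|Phi t| <= C * Nm t.
  rewrite (le_trans (ler_normD _ _))// /C mulrDl ler_wpDl ?mul1r// mulrDl !normrM -!mulrA.
  by rewrite lerD// -?mulrA ?ler_wpM2l.
have PhibN t : `|Phi (- t)| <= C * Nm t.
  rewrite (le_trans (ler_normD _ _))// opprK /C mulrDl ler_wpDl ?mul1r// mulrDl !normrM
    -!mulrA.
  by rewrite lerD// ?ler_wpM2l.
move=> j t jn It.
apply: (@gronwall _ ('I_n * bool)%type f f' (- T) T C 0 _ _ _ _ _ (Ordinal jn, false) t It).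
- by rewrite (le_trans _ C1).
- by rewrite /= in_itv/= oppr_le0 ltW.
- move=> [k []] x Ix; rewrite /f /f' /=.
    by apply: (has_deriv_opp (I := I)) => [|]; [exact: sym_itv|apply: dF'; exact: sym_itv].
  exact: dF'.
- move=> [k bb] x Ix; rewrite -/(Nm x) /f'.
  have L1 (z : R) : z <= Nm x -> z <= C * Nm x.
    by move=> h; rewrite (le_trans h)// ler_peMl.
  case: bb => /=; rewrite ?normrN /F'; case: ifPn => kn //.
    by apply: L1; exact: (NmFN (Ordinal kn)).
  by apply: L1; exact: (NmF (Ordinal kn)).
- by move=> [k []]; rewrite /f /= ?oppr0 F0.
Qed.

End ReflectionProblem.

(** * Evaluation functionals on jets *)

Section EvaluationFunctionals.
Variable R : realType.
Notation mu := (@lebesgue_measure R).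
Variables a b : R.
Notation I := `[a, b]%classic.
Local Notation fam := (nat -> R -> R).
Implicit Types (Phi Psi : fam -> R) (F : fam).

(** Finite combinations of values F j t.  All operators and boundary forms are of this
kind, which gives at once that they commute with finite sums and with integrals
depending on a parameter. *)
Definition evalfun Phi := exists s : seq (R * nat * R),
  (forall x, x \in s -> I x.2) /\ forall F, Phi F = \sum_(x <- s) x.1.1 * F x.1.2 x.2.

Lemma evalfun_pt j t : I t -> evalfun (fun F => F j t).
Proof.
move=> It; exists [:: (1, j, t)]; split.
  by move=> x /[!inE] /eqP ->.
by move=> F; rewrite big_seq1 mul1r.
Qed.

Lemma evalfun0 : evalfun (fun=> 0).
Proof. by exists [::]; split=> // F; rewrite big_nil. Qed.

Lemma evalfunD Phi Psi : evalfun Phi -> evalfun Psi -> evalfun (fun F => Phi F + Psi F).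
Proof.
move=> [s [Is sP]] [r [Ir rP]]; exists (s ++ r); split.
  by move=> x; rewrite mem_cat => /orP[/Is|/Ir].
by move=> F; rewrite big_cat sP rP.
Qed.

Lemma evalfunZ k Phi : evalfun Phi -> evalfun (fun F => k * Phi F).
Proof.
move=> [s [Is sP]]; exists [seq (k * x.1.1, x.1.2, x.2) | x <- s]; split.
  by move=> x /mapP[y ys ->] /=; exact: Is.
move=> F; rewrite big_map sP mulr_sumr; apply: eq_bigr => x _ /=.
by rewrite mulrA.
Qed.

Lemma evalfun_sum (K : Type) (r : seq K) (Phi : K -> fam -> R) :
  (forall k, evalfun (Phi k)) -> evalfun (fun F => \sum_(k <- r) Phi k F).
Proof.
move=> eP; elim: r => [|k r IH].
  have -> : (fun F => \sum_(k <- [::]) Phi k F) = fun=> 0.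
    by apply/funext => F; rewrite big_nil.
  exact: evalfun0.
have -> : (fun F => \sum_(j <- k :: r) Phi j F) =
          (fun F => Phi k F + \sum_(j <- r) Phi j F).
  by apply/funext => F; rewrite big_cons.
exact: evalfunD.
Qed.

Lemma evalfun_comb Phi (K : Type) (r : seq K) (x : K -> R) (F : K -> fam) :
  evalfun Phi ->
  Phi (fun j t => \sum_(k <- r) x k * F k j t) = \sum_(k <- r) x k * Phi (F k).
Proof.
move=> [s [_ sP]]; rewrite sP.
under eq_bigr do rewrite mulr_sumr.
rewrite exchange_big /=; apply: eq_bigr => k _; rewrite sP mulr_sumr.
by apply: eq_bigr => y _; rewrite mulrCA.
Qed.

Lemma evalfun_add Phi F G : evalfun Phi -> Phi (jet_add F G) = Phi F + Phi G.
Proof.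
move=> [s [_ sP]]; rewrite !sP -big_split; apply: eq_bigr => x _.
by rewrite /jet_add mulrDr.
Qed.

Definition itv_int (g : R -> R) : R := \int[mu]_(s in I) g s.

Lemma itv_int_primitive g : itv_int g = primitive a g b. Proof. by []. Qed.

Lemma evalfun_int Phi (F : R -> fam) (h : R -> R) : evalfun Phi ->
  (forall j t, I t -> integrable_on a b (fun s => F s j t * h s)) ->
  integrable_on a b (fun s => Phi (F s) * h s) /\
  Phi (fun j t => itv_int (fun s => F s j t * h s)) = itv_int (fun s => Phi (F s) * h s).
Proof.
move=> [s [Is sP]] iF.
pose f (x : R * nat * R) u := x.1.1 * (if x \in s then F u x.1.2 x.2 * h u else 0).
have if_ x : integrable_on a b (f x).
  have [xs|xs] := boolP (x \in s).
    apply: integrable_on_ext (integrable_onZ x.1.1 (iF x.1.2 x.2 (Is _ xs))) => u _.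
    by rewrite /f xs.
  by apply: integrable_on_ext (integrable_on0 a b) => u _; rewrite /f (negbTE xs) mulr0.
have E u : Phi (F u) * h u = \sum_(x <- s) f x u.
  rewrite sP mulr_suml [LHS]big_seq [RHS]big_seq; apply: eq_bigr => x xs.
  by rewrite /f xs mulrA.
split.
  by apply: integrable_on_ext (integrable_on_sum s if_) => u _; rewrite E.
rewrite sP; have -> : itv_int (fun u => Phi (F u) * h u) = itv_int (fun u =>
  \sum_(x <- s) f x u).
  by congr itv_int; apply/funext => u; rewrite E.
rewrite itv_int_primitive (primitive_sum s if_ (lexx b)) [LHS]big_seq [RHS]big_seq;
  apply: eq_bigr => x xs.
rewrite -(primitiveZ (iF x.1.2 x.2 (Is _ xs)))//.
by apply: eq_Rintegral => u _; rewrite /f xs.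
Qed.

End EvaluationFunctionals.

(** * Cut-off of integrands *)

Section CutOff.
Variable R : realType.
Notation mu := (@lebesgue_measure R).
Variables a b : R.
Notation I := `[a, b]%classic.

Lemma cutoffE (g : R -> R) t : (fun s => if s < t then g s else 0) = g \_ `]-oo, t[%classic.
Proof.
apply/funext => s; rewrite patchE; case: ifPn => st.
  by rewrite mem_set//= in_itv.
by rewrite memNset//= in_itv/=; exact/negP.
Qed.

Let sub t : t <= b -> I `&` `]-oo, t[%classic = `[a, t[%classic.
Proof.
move=> tb; apply/seteqP; split => x /=; rewrite !in_itv/=.
  by move=> [/andP[-> _] ->].
by move=> /andP[-> xt]; split=> //=; rewrite (le_trans (ltW xt)).
Qed.

Lemma integrable_on_cutoff g t : t <= b -> integrable_on a b g ->
  integrable_on a b (fun s => if s < t then g s else 0).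
Proof.
move=> tb ig; rewrite cutoffE /integrable_on -restrict_EFin.
apply/integrable_restrict => //; apply: integrableS ig => //.
exact: measurableI.
Qed.

Lemma itv_int_cutoff g t : t <= b -> integrable_on a b g ->
  itv_int a b (fun s => if s < t then g s else 0) = primitive a g t.
Proof.
move=> tb ig; rewrite cutoffE /itv_int -Rintegral_mkcondr sub// /primitive.
rewrite Rintegral_itv_bndo_bndc//; apply: integrableS ig => //.
by apply: subset_itv; rewrite bnd_simp.
Qed.

End CutOff.

Lemma unitmx_inj (K : fieldType) m (A : 'M[K]_m) :
  (forall x : 'rV[K]_m, x *m A = 0 -> x = 0) -> A \in unitmx.
Proof.
move=> H; rewrite -row_free_unit -kermx_eq0; apply/rowV0P => v /sub_kermxP.
exact: H.
Qed.

(** * Operators with reflection on Sobolev jets *)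

Section SobolevOp.
Variable R : realType.
Variable T : R.
Hypothesis T0 : 0 < T.
Notation I := `[- T, T]%classic.
Let TT := oppT_lt T0.

Lemma evalfun_op_act (P : reflop R) j t : I t -> evalfun (- T) T (fun F => op_act P F j t).
Proof.
move=> It; pose m := maxn (size (refl_part P)) (size (diff_part P)).
have -> : (fun F => op_act P F j t) = (fun F => \sum_(k < m)
   ((-1) ^+ j * (refl_part P)`_k * F (k + j)%N (- t) + (diff_part P)`_k * F (k + j)%N t)).
  by apply/funext => F; apply: op_actE; rewrite ?leq_maxl ?leq_maxr.
apply: evalfun_sum => k; apply: evalfunD; apply: evalfunZ; apply: evalfun_pt => //.
exact: sym_itv.
Qed.

Lemma evalfun_poly_act (p : {poly R}) j t : I t ->
  evalfun (- T) T (fun F => poly_act p F j t).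
Proof. by move=> It; apply: evalfun_sum => k; apply: evalfunZ; apply: evalfun_pt. Qed.

Lemma sobolev_primitive N F j : (0 < N)%N -> sobolev (- T) T N F -> (j < N)%N ->
  integrable_on (- T) T (F j.+1) /\ forall t, I t ->
    F j t = F j (- T) + primitive (- T) (F j.+1) t.
Proof.
move=> N0 sF jN; have [dF iF pF] := sF.
have [jN1|Nj] := ltnP j.+1 N.
  have cF := sobolev_cont TT N0 sF jN1; split; first exact: continuous_integrable_on.
  by apply: FTC2_has_deriv => // t It; exact: dF.
have E : j.+1 = N by lia.
by move: iF pF; rewrite -E /= => iF pF; split.
Qed.

(** The entry F (n + m), which is only integrable, enters the entry m of the image
and none of the lower ones. *)
Lemma sobolev_op_act n m (P : reflop R) F : (0 < m)%N ->
  (size (refl_part P) <= n.+1)%N -> (size (diff_part P) <= n.+1)%N ->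
  sobolev (- T) T (n + m) F -> sobolev (- T) T m (op_act P F).
Proof.
move=> m0 h1 h2 sF; have nm0 : (0 < n + m)%N by lia.
have [dF iF pF] := sF.
have opE j t := op_actE F j t h1 h2.
have iF' (k : 'I_n.+1) : integrable_on (- T) T (F (k + m)%N).
  have km : (k + m.-1 < n + m)%N by have := ltn_ord k; lia.
  have [H _] := sobolev_primitive nm0 sF km.
  by have -> : (k + m = (k + m.-1).+1)%N by lia.
split.
- move=> j t jm It; apply: (op_act_has_deriv h1 h2) => k kj; apply: dF => //; try lia.
  exact: sym_itv.
- apply: integrable_on_ext (integrable_on_sum (index_enum 'I_n.+1) (f := fun k s =>
    (-1) ^+ m * (refl_part P)`_k * F (k + m)%N (- s) + (diff_part P)`_k * F (k + m)%N s) _).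
    by move=> s _; rewrite opE.
  move=> k; apply: integrable_onD; apply: integrable_onZ => //.
  exact: integrable_on_opp.
- move=> t It; rewrite (@primitive_ext _ _ T _ (fun s => \sum_(k < n.+1)
    ((-1) ^+ m * (refl_part P)`_k * F (k + m)%N (- s) + (diff_part P)`_k * F (k + m)%N s)));
    [|by move: It; rewrite /= in_itv/= => /andP[]..|by move=> s _; rewrite opE].
  have tT : t <= T by move: It; rewrite /= in_itv/= => /andP[].
  rewrite (primitive_sum (b := T))//; last first.
    by move=> k; apply: integrable_onD; apply: integrable_onZ => //;
      exact: integrable_on_opp.
  rewrite !opE -big_split; apply: eq_bigr => k _ /=.
  rewrite (primitiveD (b := T)) //; [|by apply: integrable_onZ;
    exact: integrable_on_opp|exact: integrable_onZ].
  rewrite (primitiveZ (b := T) (integrable_on_opp (iF' k)))// (primitiveZ (b := T) (iF'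
    k))//.
  rewrite (primitive_opp (iF' k) It).
  have km : (k + m.-1 < n + m)%N by have := ltn_ord k; lia.
  have [_ H] := sobolev_primitive nm0 sF km.
  have Hm : (k + m = (k + m.-1).+1)%N by lia.
  rewrite Hm (H (- t)) ?(H t) ?opprK; [|exact: It|exact: sym_itv].
  rewrite (H T); last by rewrite /= in_itv/= lexx ltW.
  have -> : ((-1) ^+ m : R) = - (-1) ^+ m.-1 by rewrite -[in LHS](prednK m0) exprS mulN1r.
  by ring.
Qed.

End SobolevOp.

(** * Limits along curves *)

Section Slices.
Variable R : realType.
Implicit Types (A : set (R * R)) (f : R * R -> R).

Lemma slice_cvg A f (u : R -> R * R) (F : set_system R) (FF : Filter F) (p : R * R) :
  {within A, continuous f} -> A p -> u x @[x --> F] --> p ->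
  (\forall x \near F, A (u x)) -> f (u x) @[x --> F] --> f p.
Proof.
move=> /subspace_continuousP cf Ap up uA.
apply: (@cvg_comp _ _ _ u f _ (within A (nbhs p))); last exact: cf.
move=> P HP; have {}HP : \forall x \near p, A x -> P x by [].
have := up _ HP; rewrite /= => H; near=> x.
have : A (u x) by near: x.
by near: x.
Unshelve. all: by end_near. Qed.

Lemma near_neq (t r : R) : t <> r -> \forall x \near t, x <> r.
Proof.
move=> /eqP tr; apply/nbhs_ballP; exists `|t - r|; first by rewrite /= normr_gt0 subr_eq0.
by move=> x; rewrite /ball /= => tx xr; move: tx; rewrite xr ltxx.
Qed.

End Slices.

(** * The reduced problem and its Green's function *)

Section ReducedProblem.
Variable R : realType.
Notation mu := (@lebesgue_measure R).
Variable T : R.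
Hypothesis T0 : 0 < T.
Notation I := `[- T, T]%classic.
Variable n : nat.
Hypothesis n0 : (0 < n)%N.
Variable L : reflop R.
Hypothesis szp : (size (refl_part L) <= n.+1)%N.
Hypothesis szq : (size (diff_part L) <= n.+1)%N.
Variables alpha beta : 'M[R]_n.
Notation Q := (companion L).
Notation S := (reduced_poly L).
Hypothesis szS : size S = (n + n).+1.
Notation N := (n + n)%N.
Notation jet_bform := (jet_bform T alpha beta).
Variable e : nat -> nat -> R -> R.
Hypothesis fe : fundsys S e.
Local Notation fam := (nat -> R -> R).
Implicit Types F G : fam.

Let TT := oppT_lt T0.
Let IT : I T. Proof. by rewrite /= in_itv/= lexx ltW. Qed.
Let INT : I (- T). Proof. by rewrite /= in_itv/= lexx ltW. Qed.
Let I0 : I 0. Proof. by rewrite /= in_itv/= oppr_le0 !ltW. Qed.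
Let S1 : (1 < size S)%N. Proof. by rewrite szS; lia. Qed.
Let NE : (size S).-1 = N. Proof. by rewrite szS. Qed.
Let szq' : (size (diff_part Q) <= n.+1)%N.
Proof. exact: leq_trans (size_poly _ _) szq. Qed.

Let de k j (t : R) : is_derive t (1 : R) (e k j) (e k j.+1 t).
Proof. by have [H _ _] := fe; exact: H. Qed.
Let e0 k j : (j < N)%N -> e k j 0 = (j == k)%:R.
Proof. by have [_ H _] := fe; move=> jN; apply: H; rewrite NE. Qed.
Let Se k j t : poly_act S (e k) j t = 0.
Proof. by have [_ _ H] := fe; exact: H. Qed.

Lemma evalfun_jet_bform i : evalfun (- T) T (jet_bform i).
Proof.
apply: evalfun_sum => j; apply: evalfunD; apply: evalfunZ; exact: evalfun_pt.
Qed.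

(** The 2n boundary forms of the reduced problem; the left summand indexes the
conditions B_i Q u = 0 and the right one the conditions B_i u = 0. *)
Definition reduced_form (c : 'I_n + 'I_n) F : R :=
  match c with inl i => jet_bform i (op_act Q F) | inr i => jet_bform i F end.

Lemma evalfun_reduced_form c : evalfun (- T) T (reduced_form c).
Proof.
case: c => i; last exact: evalfun_jet_bform.
by apply: evalfun_sum => j; apply: evalfunD; apply: evalfunZ; exact: evalfun_op_act.
Qed.

Definition fund_comb (x : 'rV[R]_N) : fam := fun j t => \sum_(k < N) x 0 k * e k j t.

Lemma fund_comb_derive x j (t : R) : has_deriv I (fund_comb x j) t (fund_comb x j.+1 t).
Proof.
apply: has_deriv_sum => k _; apply: has_derivZ; apply: has_deriv_is_derive; exact: de.
Qed.

Lemma fund_comb_at0 x (j : 'I_N) : fund_comb x j 0 = x 0 j.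
Proof.
rewrite /fund_comb (bigD1 j)//= e0// eqxx mulr1 big1 ?addr0// => k kj.
rewrite e0// (_ : (j == k :> nat) = false) ?mulr0//.
by apply/negbTE; apply: contraNneq kj => jk; apply/eqP/val_inj.
Qed.

Lemma poly_act_fund_comb x j t : I t -> poly_act S (fund_comb x) j t = 0.
Proof.
move=> It; rewrite (evalfun_comb _ _ _ (evalfun_poly_act S j It)) big1// => k _.
by rewrite Se mulr0.
Qed.

Lemma smooth_zero F : (forall j t, I t -> has_deriv I (F j) t (F j.+1 t)) ->
  (forall t, I t -> F 0 t = 0) -> forall j t, I t -> F j t = 0.
Proof.
move=> dF F0; elim=> [//|j IH] t It.
apply: (has_deriv_unique TT It (dF j t It)).
apply: (@has_deriv_eq _ _ (fun=> 0)) => //; last exact: has_deriv_cst.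
by move=> x /set_mem Ix; rewrite IH.
Qed.

Hypothesis hom : forall F, (forall j t, I t -> has_deriv I (F j) t (F j.+1 t)) ->
  (forall t, I t -> poly_act S F 0 t = 0) -> (forall c, reduced_form c F = 0) ->
  forall t, I t -> F 0 t = 0.

Definition bc_matrix : 'M[R]_N := \matrix_(k, c) reduced_form (fintype.split c) (e k).

Lemma reduced_form_fund_comb (x : 'rV[R]_N) c :
  reduced_form (fintype.split c) (fund_comb x) = (x *m bc_matrix) 0 c.
Proof.
rewrite (evalfun_comb _ _ _ (evalfun_reduced_form _)) mxE; apply: eq_bigr => k _.
by rewrite mxE.
Qed.

(** A vector annihilated by the matrix gives a solution of the homogeneous reduced
problem, hence zero. *)
Lemma bc_matrix_unit : bc_matrix \in unitmx.
Proof.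
apply: unitmx_inj => x xM; apply/rowP => k; rewrite mxE -fund_comb_at0.
apply: (smooth_zero (F := fund_comb x)) => //; first by move=> j t _;
  exact: fund_comb_derive.
apply: hom => [j t _|t It|c]; first exact: fund_comb_derive.
  exact: poly_act_fund_comb.
by rewrite -(unsplitK c) reduced_form_fund_comb xM mxE.
Qed.

(** The solutions w_i of S w = 0 with B_j Q w_i = delta_ij and B_j w_i = 0 produce
u_i = Q w_i in ker L with B_j u_i = delta_ij.  The matrix J of the derivatives of
the u_i at 0 is invertible: a combination with zero data at 0 vanishes by
reflop_uniq, so its boundary values, which are the coefficients, vanish.  Hence F
differs from a combination of the u_i by a solution with zero data at 0, that is,
by zero, and B F = 0 forces the coefficients to be zero. *)
Lemma kernel_uniq F : sobolev (- T) T n F ->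
  {ae mu, forall t, I t -> op_act L F 0 t = 0} -> (forall i, jet_bform i F = 0) ->
  forall j t, (j < n)%N -> I t -> F j t = 0.
Proof.
move=> sF LF BF.
pose w (i : 'I_n) := fund_comb (delta_mx 0 (lshift n i) *m invmx bc_matrix).
have Lw i c : reduced_form (fintype.split c) (w i) = (lshift n i == c)%:R.
  by rewrite reduced_form_fund_comb mulmxKV ?bc_matrix_unit// mxE eqxx eq_sym.
pose u i : fam := op_act Q (w i).
have du i j t : I t -> has_deriv I (u i j) t (u i j.+1 t).
  by move=> It; apply: (op_act_has_deriv (p := n)) => // *; exact: fund_comb_derive.
have Bu i i' : jet_bform i' (u i) = (i == i')%:R.
  have := Lw i (lshift n i'); rewrite (unsplitK (inl i')) /= => ->.
  by rewrite (inj_eq (@lshift_inj _ _)).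
have Lu i t : I t -> op_act L (u i) 0 t = 0.
  by move=> It; rewrite /u op_act_companionr poly_act_fund_comb.
pose U (x : 'rV[R]_n) : fam := fun j t => \sum_i x 0 i * u i j t.
have dU x j t : I t -> has_deriv I (U x j) t (U x j.+1 t).
  by move=> It; apply: has_deriv_sum => i _; apply: has_derivZ; exact: du.
have sU x : sobolev (- T) T n (U x) by exact: (smooth_sobolev TT n0 (dU x)).
have LU x t : I t -> op_act L (U x) 0 t = 0.
  move=> It; rewrite (evalfun_comb _ _ _ (evalfun_op_act L 0 It)) big1// => i _.
  by rewrite Lu// mulr0.
have BU x i : jet_bform i (U x) = x 0 i.
  rewrite (evalfun_comb _ _ _ (evalfun_jet_bform i)) (bigD1 i)//= Bu eqxx mulr1.
  by rewrite big1 ?addr0// => i' i'i; rewrite Bu (negbTE i'i) mulr0.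
have zero G : sobolev (- T) T n G -> {ae mu, forall t, I t -> op_act L G 0 t = 0} ->
    (forall j, (j < n)%N -> G j 0 = 0) -> forall j t, (j < n)%N -> I t -> G j t = 0.
  by move=> *; apply: (reflop_uniq T0 n0 szp szq szS (F := G)).
have jet_bform0 G i : (forall j t, (j < n)%N -> I t -> G j t = 0) -> jet_bform i G = 0.
  by move=> H; apply: big1 => j _; rewrite !H// !mulr0 addr0.
pose J : 'M[R]_n := \matrix_(i, j) u i j 0.
have UJ x (j : 'I_n) : U x j 0 = (x *m J) 0 j.
  by rewrite mxE; apply: eq_bigr => i _; rewrite mxE.
have Junit : J \in unitmx.
  apply: unitmx_inj => x xJ; apply/rowP => i; rewrite mxE -(BU x i); apply: jet_bform0.
  apply: zero => //; first by apply: ae_all => t; exact: LU.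
  by move=> j jn; rewrite (UJ x (Ordinal jn)) xJ mxE.
pose x := (\row_j F j 0) *m invmx J.
have Ux (j : 'I_n) : U x j 0 = F j 0 by rewrite UJ mulmxKV// mxE.
pose G := jet_add F (fun j t => -1 * U x j t).
have G0 : forall j t, (j < n)%N -> I t -> G j t = 0.
  apply: zero.
  - by apply: sobolevD => //; apply: sobolevZ.
  - apply: ae_imp LF => t H It.
    rewrite (evalfun_add _ _ (evalfun_op_act L 0 It)) H// add0r.
    have := evalfun_comb [:: tt] (fun=> -1) (fun=> U x) (evalfun_op_act L 0 It).
    rewrite big_seq1 LU// mulr0 => <-; congr op_act.
    by apply/funext => j; apply/funext => s; rewrite big_seq1.
  - by move=> j jn; rewrite /G /jet_add (Ux (Ordinal jn)) mulN1r subrr.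
have x0 : x = 0.
  apply/rowP => i; rewrite [RHS]mxE -(BU x i).
  have := jet_bform0 G i G0; rewrite (evalfun_add _ _ (evalfun_jet_bform i)) BF add0r.
  have := evalfun_comb [:: tt] (fun=> -1) (fun=> U x) (evalfun_jet_bform i).
  rewrite big_seq1 mulN1r.
  have -> : (fun j t => \sum_(k <- [:: tt]) -1 * U x j t) = (fun j t => -1 * U x j t).
    by apply/funext => j; apply/funext => s; rewrite big_seq1.
  by move=> -> /eqP; rewrite oppr_eq0 => /eqP.
move=> j t jn It; have := G0 j t jn It; rewrite /G /jet_add /U x0.
by rewrite big1 ?mulr0 ?addr0// => i _; rewrite mxE mul0r.
Qed.

Definition inv_lead : R := (lead_coef S)^-1.
(** Coefficients on the fundamental system of t |-> K (t - s), where K is the impulse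
response: S K = 0, with derivatives at 0 equal to 0 up to order N - 2 and to
1 / lead_coef S in order N - 1. *)
Definition impulse_coef (k : nat) (s : R) : R := inv_lead * e N.-1 k (- s).
Definition causal_coef (k : nat) (t s : R) : R := if s < t then impulse_coef k s else 0.
Definition causal_jet (s : R) : fam := fun j t => \sum_(k < N) causal_coef k t s * e k j t.
Definition bc_correction (s : R) : 'rV[R]_N :=
  - ((\row_c reduced_form (fintype.split c) (causal_jet s)) *m invmx bc_matrix).
(** The jet of G(., s) off the diagonal: the causal solution K (t - s) for t > s,
corrected by a solution of S u = 0 so as to satisfy the boundary conditions. *)
Definition green_jet (s : R) : fam := jet_add (fund_comb (bc_correction s)) (causal_jet s).

(** Both sides are solutions in t, and they have the same derivatives at t = 0. *)
Lemma impulse_expand (j : nat) (t s : R) : (j < N)%N ->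
  \sum_(k < N) impulse_coef k s * e k j t = inv_lead * e N.-1 j (t - s).
Proof.
move=> jN.
pose F j t := inv_lead * e N.-1 j (t - s).
pose c := Num.min 0 t; pose d := Num.max 0 t.
have [c0 d0] : c <= 0 /\ 0 <= d by rewrite /c /d ge_min le_max lexx.
have [ct td] : c <= t /\ t <= d by rewrite /c /d ge_min le_max lexx !orbT.
have Ic : `[c, d]%classic 0 by rewrite /= in_itv/= c0.
have It : `[c, d]%classic t by rewrite /= in_itv/= ct.
have dF i x : has_deriv `[c, d] (F i) x (F i.+1 x).
  apply: has_derivZ; apply: has_deriv_is_derive.
  have := @is_derive1_comp _ (e N.-1 i) (fun x => x - s) x _ 1 (de _ i (x - s)) _.
  rewrite mulr1; apply.
  have := @is_deriveB _ _ _ id (cst s) x 1 _ _ (is_derive_id _ _) (is_derive_cst _ _ _).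
  by rewrite subr0.
have := @fundsys_expand _ S S1 e F c d 0 fe Ic _ _ j t _ It.
rewrite NE => H; rewrite -[RHS]/(F j t) H //.
- by apply: eq_bigr => k _; rewrite subr0 /F sub0r.
- by move=> x _; rewrite /poly_act /F; under eq_bigr do rewrite mulrCA;
    rewrite -mulr_sumr -[X in _ * X]/(poly_act S (e N.-1) 0 (x - s)) Se mulr0.
Qed.

Lemma impulse_diag (j : nat) (t : R) : (j < N)%N ->
  \sum_(k < N) impulse_coef k t * e k j t = if j == N.-1 then inv_lead else 0.
Proof.
move=> jN; rewrite impulse_expand// subrr e0//.
by case: eqP; rewrite ?mulr1 ?mulr0.
Qed.

Lemma impulse_coef_cont k : {within I, continuous (impulse_coef k)}.
Proof.
apply: within_contZ; apply: (within_cont_opp (f := e N.-1 k)).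
exact: (is_derive_within_cont (de N.-1 k)).
Qed.

Lemma reduced_form_green_jet s c : reduced_form (fintype.split c) (green_jet s) = 0.
Proof.
rewrite (evalfun_add _ _ (evalfun_reduced_form _)) reduced_form_fund_comb
  /bc_correction mulNmx mulmxKV ?bc_matrix_unit//.
by rewrite !mxE addNr.
Qed.

Section Existence.
Variable h : R -> R.
Hypothesis ih : integrable_on (- T) T h.

Let itT t : I t -> t <= T. Proof. by rewrite /= in_itv/= => /andP[]. Qed.

Let ikh (k : nat) : integrable_on (- T) T (fun s => impulse_coef k s * h s).
Proof. by apply: integrable_onM => //; exact: impulse_coef_cont. Qed.

Let H k t := primitive (- T) (fun s => impulse_coef k s * h s) t.

Lemma causal_coef_integrable k t : I t ->
  integrable_on (- T) T (fun s => causal_coef k t s * h s).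
Proof.
move=> It; apply: integrable_on_ext (integrable_on_cutoff (itT It) (ikh k)) => s _.
by rewrite /causal_coef; case: ifPn => //; rewrite mul0r.
Qed.

(** For fixed t the jet is a combination of continuous functions of s, cut off
at t. *)
Lemma causal_jet_integrable j t : I t ->
  integrable_on (- T) T (fun s => causal_jet s j t * h s).
Proof.
move=> It.
apply: integrable_on_ext (integrable_on_sum (index_enum 'I_N) (fun k : 'I_N =>
  integrable_onZ (e k j t) (causal_coef_integrable k It))) => s _.
by rewrite /causal_jet mulr_suml; apply: eq_bigr => k _; ring.
Qed.

Lemma bc_correction_integrable k :
  integrable_on (- T) T (fun s => bc_correction s 0 k * h s).
Proof.
have iL c : integrable_on (- T) T (fun s =>
  reduced_form (fintype.split c) (causal_jet s) * h s).
  by have [] := evalfun_int (F := causal_jet) (h := h) (evalfun_reduced_form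
    (fintype.split c)) causal_jet_integrable.
apply: integrable_on_ext (integrable_on_sum (index_enum 'I_N)
   (fun c : 'I_N => integrable_onZ (- invmx bc_matrix c k) (iL c))) => s _.
rewrite /bc_correction !mxE -sumrN mulr_suml; apply: eq_bigr => c _; rewrite mxE; ring.
Qed.

Lemma green_jet_integrable j t : I t ->
  integrable_on (- T) T (fun s => green_jet s j t * h s).
Proof.
move=> It.
have H1 := integrable_on_sum (index_enum 'I_N) (fun k : 'I_N =>
  integrable_onZ (e k j t) (bc_correction_integrable k)).
apply: integrable_on_ext (integrable_onD H1 (causal_jet_integrable j It)) => s _.
rewrite /green_jet /jet_add /fund_comb mulrDl; congr (_ + _).
by rewrite mulr_suml; apply: eq_bigr => k _; ring.
Qed.

Definition green_pot : fam := fun j t => itv_int (- T) T (fun s => green_jet s j t * h s).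
Let Dk (k : 'I_N) := itv_int (- T) T (fun s => bc_correction s 0 k * h s).

Lemma green_potE j t : I t ->
  green_pot j t = \sum_(k < N) Dk k * e k j t + \sum_(k < N) e k j t * H k t.
Proof.
move=> It; rewrite /green_pot.
have H1 := integrable_on_sum (index_enum 'I_N) (fun k : 'I_N =>
  integrable_onZ (e k j t) (bc_correction_integrable k)).
have H2 := integrable_on_sum (index_enum 'I_N) (fun k : 'I_N =>
  integrable_onZ (e k j t) (causal_coef_integrable k It)).
transitivity (itv_int (- T) T (fun s =>
  \sum_(k < N) e k j t * (bc_correction s 0 k * h s) + \sum_(k < N) e k j t *
    (causal_coef k t s * h s))).
  congr itv_int; apply/funext => s;
    rewrite /green_jet /jet_add /fund_comb /causal_jet mulrDl !mulr_suml.
  by congr (_ + _); apply: eq_bigr => k _; ring.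
rewrite itv_int_primitive (primitiveD H1 H2)//; congr (_ + _).
  rewrite (primitive_sum _ (fun k : 'I_N =>
    integrable_onZ (e k j t) (bc_correction_integrable k)))//.
  by apply: eq_bigr => k _; rewrite (primitiveZ (bc_correction_integrable k))// mulrC.
rewrite (primitive_sum _ (fun k : 'I_N =>
  integrable_onZ (e k j t) (causal_coef_integrable k It)))//.
apply: eq_bigr => k _; rewrite (primitiveZ (causal_coef_integrable k It))//; congr (_ * _).
rewrite -itv_int_primitive /H -(itv_int_cutoff (itT It) (ikh k)); congr itv_int;
  apply/funext => s.
by rewrite /causal_coef; case: ifPn => //; rewrite mul0r.
Qed.

(** The diagonal values of the kernel are the derivatives of K at 0, so only the
last derivative picks up a multiple of h. *)
Lemma green_pot_deriv j t : (j < N)%N -> I t ->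
  has_deriv I
    (fun t => green_pot j t - (if j == N.-1 then inv_lead else 0) * primitive (- T) h t)
    t (green_pot j.+1 t).
Proof.
move=> jN It; rewrite green_potE//.
have := variation_of_constants TT (f := fun k : 'I_N => e k j) (f' := fun k : 'I_N =>
  e k j.+1)
  (kap := fun k : 'I_N =>
    impulse_coef k) (h := h) (c := if j == N.-1 then inv_lead else 0) _ _ _ _ ih.
move=> /(_ _ _ _ _ t It) Hd.
apply: (@has_deriv_eq _ _ (fun t => \sum_(k < N) Dk k * e k j t +
  (\sum_(k < N) e k j t * H k t - (if j == N.-1 then inv_lead else 0) * primitive (- T)
    h t))) => //.
  by move=> x /set_mem Ix; rewrite green_potE// addrA.
apply: has_derivD.
  by apply: has_deriv_sum => k _; apply: has_derivZ; apply: has_deriv_is_derive; exact: de.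
apply: Hd.
- by move=> k x; exact: de.
- by move=> k; exact: (is_derive_within_cont (de k j.+1)).
- by move=> k; exact: impulse_coef_cont.
- by move=> x Ix; rewrite -(impulse_diag x jN); apply: eq_bigr => k _; rewrite mulrC.
Qed.

Lemma green_pot_cont : {within I, continuous (green_pot N)}.
Proof.
apply: (@within_cont_ext _ _ _ (fun t =>
  \sum_(k < N) Dk k * e k N t + \sum_(k < N) e k N t * H k t)).
  by move=> x /set_mem Ix; rewrite green_potE.
apply: within_contD; apply: within_cont_sum => k.
  apply: within_contZ; exact: (is_derive_within_cont (de k N)).
apply/within_contP => t It.
have /within_contP h1 := is_derive_within_cont (a := - T) (b := T) (de k N).
have /within_contP h2 := primitive_continuous TT (ikh k).
by apply: cvgM; [exact: h1|exact: h2].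
Qed.

(** Differentiating the kernel N times under the integral misses the multiple of h
created by the jump. *)
Definition weak_pot : fam :=
  fun j t => if (j < N)%N then green_pot j t else green_pot j t + inv_lead * h t.

Lemma sobolev_weak_pot : sobolev (- T) T N weak_pot.
Proof.
have N0 : (0 < N)%N by lia.
split.
- move=> j t jN It; rewrite /weak_pot jN (ltnW jN).
  have := green_pot_deriv (ltnW jN) It.
  have -> : (j == N.-1) = false by lia.
  by apply: has_deriv_eq => // x _; rewrite /= mul0r subr0.
- rewrite /weak_pot ltnn; apply: integrable_onD; last exact: integrable_onZ.
  by apply: continuous_integrable_on; exact: green_pot_cont.
- move=> t It; rewrite /weak_pot ltn_predL N0 ltnn.
  have jN : (N.-1 < N)%N by lia.
  have dW x : I x -> has_deriv I (fun t =>
    green_pot N.-1 t - inv_lead * primitive (- T) h t) x (green_pot N x).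
    by move=> Ix; have := green_pot_deriv jN Ix; rewrite eqxx prednK.
  have := FTC2_has_deriv TT green_pot_cont dW It.
  rewrite primitive0 mulr0 subr0 => /eqP; rewrite subr_eq => /eqP ->.
  have icW := continuous_integrable_on green_pot_cont.
  by rewrite (primitiveD icW (integrable_onZ inv_lead ih)) ?(primitiveZ ih) ?addrA//;
    exact: itT.
Qed.

Lemma poly_act_green_jet s t : I t -> poly_act S (green_jet s) 0 t = 0.
Proof.
move=> It.
rewrite (evalfun_add _ _ (evalfun_poly_act S 0 It)) poly_act_fund_comb// add0r.
rewrite /poly_act /causal_jet; under eq_bigr do rewrite mulr_sumr.
rewrite exchange_big big1//= => k _.
under eq_bigr do rewrite mulrCA.
by rewrite -mulr_sumr -[X in _ * X]/(poly_act S (e k) 0 t) Se mulr0.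
Qed.

(** The kernel contributes nothing, and the leading coefficient of S cancels the
inverse in front of h. *)
Lemma poly_act_weak_pot t : I t -> poly_act S weak_pot 0 t = h t.
Proof.
move=> It.
have [_ HW] := evalfun_int (F := green_jet) (h := h) (evalfun_poly_act S 0 It)
  green_jet_integrable.
have W0 : poly_act S green_pot 0 t = 0.
  rewrite [LHS]HW itv_int_primitive.
  rewrite (@primitive_ext _ _ T _ (fun=> 0)) ?primitive_cst ?mul0r ?(ltW TT)//.
  by move=> s _; rewrite poly_act_green_jet// mul0r.
have E1 : poly_act S weak_pot 0 t = poly_act S green_pot 0 t + S`_N * (inv_lead * h t).
  rewrite !(@poly_actE _ N.+1 S _ 0 t) ?szS// !big_ord_recr /= !addn0 /weak_pot ltnn.
  rewrite mulrDr addrA; congr (_ + _ + _).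
  by apply: eq_bigr => k _; rewrite addn0 ltn_ord.
rewrite E1 W0 add0r mulrA /inv_lead.
rewrite lead_coefE NE mulfV ?mul1r//.
by rewrite -NE -lead_coefE lead_coef_eq0 -size_poly_gt0 ltnW.
Qed.

(** Q w, the solution of the original problem. *)
Definition rsol : fam := op_act Q weak_pot.

Lemma sobolev_rsol : sobolev (- T) T n rsol.
Proof. exact: (sobolev_op_act (P := Q) T0 n0 szp szq' sobolev_weak_pot). Qed.

Lemma op_act_rsol t : I t -> op_act L rsol 0 t = h t.
Proof. by move=> It; rewrite /rsol op_act_companionr poly_act_weak_pot. Qed.

Lemma rsolE j t : (j < n)%N -> rsol j t = op_act Q green_pot j t.
Proof.
move=> jn; rewrite /rsol !(op_actE (P := Q) _ _ _ szp szq'); apply: eq_bigr => k _.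
by rewrite /weak_pot (_ : (k + j < N)%N)//; have := ltn_ord k; lia.
Qed.

Lemma jet_bform_rsol i : jet_bform i rsol = 0.
Proof.
transitivity (reduced_form (inl i) green_pot).
  by apply: eq_bigr => j _; rewrite !rsolE.
have [_ ->] := evalfun_int (F := green_jet) (h := h) (evalfun_reduced_form (inl i))
  green_jet_integrable.
rewrite itv_int_primitive (@primitive_ext _ _ T _ (fun=> 0)) ?primitive_cst ?mul0r
  ?(ltW TT)//.
move=> s _; have := reduced_form_green_jet s (lshift n i); rewrite (unsplitK (inl i)) => ->.
by rewrite mul0r.
Qed.

Lemma rsol_int t : I t ->
  integrable_on (- T) T (fun s => op_act Q (green_jet s) 0 t * h s) /\
  rsol 0 t = itv_int (- T) T (fun s => op_act Q (green_jet s) 0 t * h s).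
Proof.
move=> It; rewrite rsolE//.
by have := evalfun_int (F := green_jet) (h := h) (evalfun_op_act Q 0 It)
  green_jet_integrable.
Qed.

End Existence.

Section Green.
Variable G : R -> R -> R.
Hypothesis greenG : is_green (- T) T S (reduced_bc T Q alpha beta) G.

Let g j t s : R := pderiv (- T) T j G t s.
Let offdiag := [set p : R * R | I p.1 /\ I p.2 /\ p.1 <> p.2].

Let green12 k : (k.+2 <= N)%N -> {within I `*` I, continuous (fun p => g k p.1 p.2)}.
Proof.
by move=> kN; have [+ _ _ _ _] := greenG; rewrite NE => /(_ k kN) [].
Qed.

Let green_pred : {within offdiag, continuous (fun p => g N.-1 p.1 p.2)}.
Proof.
by have [_ + _ _ _] := greenG; rewrite NE => /(_ N.-1 (or_introl erefl)) [].
Qed.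

Let green_nder s : I s -> nderivable I (I `\ s) N (G ^~ s).
Proof.
by move=> Is; have [_ + _ _ _] := greenG; rewrite NE => /(_ N (or_intror erefl)) [+ _];
  apply.
Qed.

Let green_deriv s j t : I s -> I t -> t <> s -> (j < N)%N ->
  has_deriv I (g j ^~ s) t (g j.+1 t s).
Proof.
by move=> Is It ts jN; apply: (nderivable_has_deriv (green_nder Is)).
Qed.

Let itI s : - T < s < T -> I s.
Proof. by rewrite /= in_itv/= => /andP[? ?]; rewrite !ltW. Qed.

Let green_ode s t : - T < s < T -> I t -> t <> s ->
  poly_act S (fun j t => g j t s) 0 t = 0.
Proof.
move=> sT It ts; have [_ _ _ /(_ s sT t It ts) H _] := greenG.
by rewrite -H /poly_act /diffop; apply: eq_bigr => k _; rewrite addn0.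
Qed.

(** The solution of S u = 0 with derivatives y at the point r. *)
Definition shift_comb (y : nat -> R) (r : R) : nat -> R -> R :=
  fun j t => \sum_(k < N) y k * e k j (t - r).

Lemma shift_comb_derive y r j (t : R) :
  is_derive t (1 : R) (shift_comb y r j) (shift_comb y r j.+1 t).
Proof.
apply: (@is_derive_has_deriv _ setT); first by near=> x.
apply: has_deriv_sum => k _; apply: has_derivZ; apply: has_deriv_is_derive.
have := @is_derive1_comp _ (e k j) (fun x => x - r) t _ 1 (de _ j (t - r)) _.
rewrite mulr1; apply.
have := @is_deriveB _ _ _ id (cst r) t 1 _ _ (is_derive_id _ _) (is_derive_cst _ _ _).
by rewrite subr0.
Unshelve. all: by end_near. Qed.

Lemma poly_act_shift_comb y r t : poly_act S (shift_comb y r) 0 t = 0.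
Proof.
rewrite /poly_act /shift_comb; under eq_bigr do rewrite mulr_sumr.
rewrite exchange_big big1//= => k _.
under eq_bigr do rewrite mulrCA.
by rewrite -mulr_sumr -[X in _ * X]/(poly_act S (e k) 0 (t - r)) Se mulr0.
Qed.

Lemma shift_comb_cont y r j : continuous (shift_comb y r j).
Proof.
move=> t; apply: differentiable_continuous; apply/derivable1_diffP.
by have [] := shift_comb_derive y r j t.
Qed.

Let solve_expand F (r t : R) j : I r -> I t -> (j < N)%N ->
  (forall i x, (i < N)%N -> `[Num.min r t, Num.max r t]%classic x ->
    has_deriv I (F i) x (F i.+1 x)) ->
  (forall x, `[Num.min r t, Num.max r t]%classic x -> poly_act S F 0 x = 0) ->
  F j t = shift_comb (F ^~ r) r j t.
Proof.
move=> Ir It jN dF SF.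
set c := Num.min r t in dF SF; set d := Num.max r t in dF SF.
have Icr : `[c, d]%classic r by rewrite /= in_itv/= /c /d ge_min le_max lexx.
have Ict : `[c, d]%classic t by rewrite /= in_itv/= /c /d ge_min le_max lexx !orbT.
have sub x : `[c, d]%classic x -> I x.
  move: Ir It; rewrite /= !in_itv/= => /andP[h1 h2] /andP[h3 h4] /andP[h5 h6].
  by rewrite (le_trans _ h5) ?(le_trans h6)// /c /d ?ge_max ?le_min ?h1 ?h3 ?h2.
have := @fundsys_expand _ S S1 e F c d r fe Icr _ _ j t _ Ict.
rewrite NE; apply => //.
by move=> i x iN Ix; apply: (has_derivS sub); exact: dF.
Qed.

Let right_expand s t j : - T < s < T -> s < t -> t <= T -> (j < N)%N ->
  g j t s = shift_comb (fun k => g k T s) T j t.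
Proof.
move=> sT st tT jN.
have It : I t by rewrite /= in_itv/= tT andbT; case/andP: sT => h _;
  rewrite ltW// (lt_trans h).
have ok x : `[Num.min T t, Num.max T t]%classic x -> I x /\ x <> s.
  rewrite (min_idPr tT) (max_idPl tT) /= in_itv/= => /andP[tx xT].
  have sx := lt_le_trans st tx.
  split; last by move=> xs; rewrite xs ltxx in sx.
  rewrite in_itv/= xT andbT ltW//; apply: lt_trans sx; by case/andP: sT.
apply: (solve_expand (F := fun j t => g j t s)) => //.
- by move=> i x iN /ok[Ix xs]; apply: green_deriv => //; exact: itI.
- by move=> x /ok[Ix xs]; apply: green_ode.
Qed.

Let left_expand s t j : - T < s < T -> t < s -> - T <= t -> (j < N)%N ->
  g j t s = shift_comb (fun k => g k (- T) s) (- T) j t.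
Proof.
move=> sT st tT jN.
have It : I t by rewrite /= in_itv/= tT/=; case/andP: sT => _ h;
  rewrite ltW// (lt_trans st).
have ok x : `[Num.min (- T) t, Num.max (- T) t]%classic x -> I x /\ x <> s.
  rewrite (min_idPl tT) (max_idPr tT) /= in_itv/= => /andP[tx xT].
  have sx := le_lt_trans xT st.
  split; last by move=> xs; rewrite xs ltxx in sx.
  rewrite in_itv/= tx/= ltW//; apply: lt_trans sx _; by case/andP: sT.
apply: (solve_expand (F := fun j t => g j t s)) => //.
- by move=> i x iN /ok[Ix xs]; apply: green_deriv => //; exact: itI.
- by move=> x /ok[Ix xs]; apply: green_ode.
Qed.

Let near_itv s : - T < s < T -> \forall x \near s, - T < x < T.
Proof.
move=> sT; have sT' : s \in `]- T, T[ by rewrite in_itv.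
by have := near_in_itvoo sT'; apply: filterS => x; rewrite /= in_itv.
Qed.

(** At an end point t = r the derivatives of G(., s) are taken off the diagonal, so they
are continuous in s up to the order N - 1. *)
Let edge_cont (r s : R) k : r = T \/ r = - T -> - T < s < T -> (k < N)%N ->
  g k r x @[x --> s] --> g k r s.
Proof.
move=> rE sT kN.
have Ir : I r by case: rE => ->.
have rs x : - T < x < T -> r <> x.
  by case: rE => -> /andP[h1 h2] E; move: h1 h2; rewrite -?E ltxx.
have ur : (r, x) @[x --> s] --> (r, s)
  by apply: (@cvg_pair _ _ _ (nbhs s) (nbhs r) (nbhs s)); [exact: cvg_cst|exact: cvg_id].
have [kN2|Nk] := leqP k.+2 N.
  apply: (slice_cvg (u := fun x => (r, x)) (p := (r, s)) _ (green12 kN2)) => //.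
    by split=> //=; exact: itI.
  by have := near_itv sT; apply: filterS => x xT; split=> //=; exact: itI.
have -> : k = N.-1 by lia.
apply: (slice_cvg (u := fun x => (r, x)) (p := (r, s)) _ green_pred) => //.
  by split=> //=; split; [exact: itI|exact: rs].
have := near_itv sT; apply: filterS => x xT.
by split=> //=; split; [exact: itI|exact: rs].
Qed.

Let shift_comb_edge_cont (r s t : R) j : r = T \/ r = - T -> - T < s < T ->
  shift_comb (fun k => g k r x) r j t @[x --> s] --> shift_comb (fun k => g k r s) r j t.
Proof.
move=> rE sT; rewrite /shift_comb.
apply: cvg_big => [|k _]; first exact: add_continuous.
by apply: cvgM; [exact: edge_cont|exact: cvg_cst].
Qed.

(** Up to the order N - 2 the derivatives are continuous across the diagonal. *)
Let diag_right s k : - T < s < T -> (k.+2 <= N)%N ->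
  shift_comb (fun i => g i T s) T k s = g k s s.
Proof.
move=> sT kN; have Is := itI sT.
have [sT1 sT2] : - T < s /\ s < T by apply/andP.
have c1 : g k x s @[x --> s^'+] --> g k s s.
  apply: (slice_cvg (u := fun x => (x, s)) (p := (s, s)) _ (green12 kN)) => //.
    apply: (@cvg_pair _ _ _ s^'+ (nbhs s) (nbhs s)); last exact: cvg_cst.
    by apply: cvg_at_right_filter; exact: cvg_id.
  have := near_itv sT; move=> /(@cvg_at_right_filter _ _ id s s (@cvg_id _ _)) H.
  by apply: filterS H => x xT; split=> //=; exact: itI.
have c2 : shift_comb (fun i => g i T s) T k x @[x --> s^'+] --> shift_comb (fun i =>
  g i T s) T k s.
  by apply: cvg_at_right_filter; exact: shift_comb_cont.
apply: (cvg_unique _ c2); first exact: Rhausdorff.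
apply: cvg_trans c1; apply: near_eq_cvg; near=> x.
have xs : s < x by near: x; exact: nbhs_right_gt.
have xT : x <= T by near: x; exact: nbhs_right_le.
by rewrite right_expand//; lia.
Unshelve. all: by end_near. Qed.

Let diag_left s k : - T < s < T -> (k.+2 <= N)%N ->
  shift_comb (fun i => g i (- T) s) (- T) k s = g k s s.
Proof.
move=> sT kN; have Is := itI sT.
have [sT1 sT2] : - T < s /\ s < T by apply/andP.
have c1 : g k x s @[x --> s^'-] --> g k s s.
  apply: (slice_cvg (u := fun x => (x, s)) (p := (s, s)) _ (green12 kN)) => //.
    apply: (@cvg_pair _ _ _ s^'- (nbhs s) (nbhs s)); last exact: cvg_cst.
    by apply: cvg_at_left_filter; exact: cvg_id.
  have := near_itv sT; move=> /(@cvg_at_left_filter _ _ id s s (@cvg_id _ _)) H.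
  by apply: filterS H => x xT; split=> //=; exact: itI.
have c2 : shift_comb (fun i =>
  g i (- T) s) (- T) k x @[x --> s^'-] --> shift_comb (fun i => g i (- T) s) (- T) k s.
  by apply: cvg_at_left_filter; exact: shift_comb_cont.
apply: (cvg_unique _ c2); first exact: Rhausdorff.
apply: cvg_trans c1; apply: near_eq_cvg; near=> x.
have xs : x < s by near: x; exact: nbhs_left_lt.
have xT : - T <= x by near: x; exact: nbhs_left_ge.
by rewrite left_expand//; lia.
Unshelve. all: by end_near. Qed.

(** Both lateral limits along s are computed from the expansions at the end points,
which depend continuously on s; their values at s are the lateral limits
along t. *)
Let jump s : - T < s < T ->
  shift_comb (fun i => g i T s) T N.-1 s - shift_comb (fun i => g i (- T) s) (- T) N.-1 s
  = inv_lead.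
Proof.
move=> sT; have N1 : (N.-1 < N)%N by lia.
(* As x -> s^- the point s lies to the right of x, hence the expansion at T. *)
have [sT1 sT2] : - T < s /\ s < T by apply/andP.
have [_ _ + _ _] := greenG; move=> /(_ s sT) [lm [lp [+ + lmp]]].
rewrite NE => clm clp.
rewrite /inv_lead -lmp; congr (_ - _).
- have c2 : shift_comb (fun i =>
  g i T x) T N.-1 s @[x --> s^'-] --> shift_comb (fun i => g i T s) T N.-1 s.
    by apply: cvg_at_left_filter; apply: shift_comb_edge_cont => //; left.
  apply: (cvg_unique _ c2); first exact: Rhausdorff.
  apply: cvg_trans clm; apply: near_eq_cvg; near=> x.
  have xs : x < s by near: x; exact: nbhs_left_lt.
  have xT : - T < x by near: x; exact: nbhs_left_gt.
  by rewrite -[LHS]/(g N.-1 s x) right_expand ?(ltW sT2)// xT (lt_trans xs).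
- have c2 : shift_comb (fun i =>
  g i (- T) x) (- T) N.-1 s @[x --> s^'+] --> shift_comb (fun i =>
    g i (- T) s) (- T) N.-1 s.
    by apply: cvg_at_right_filter; apply: shift_comb_edge_cont => //; right.
  apply: (cvg_unique _ c2); first exact: Rhausdorff.
  apply: cvg_trans clp; apply: near_eq_cvg; near=> x.
  have xs : s < x by near: x; exact: nbhs_right_gt.
  have xT : x < T by near: x; exact: nbhs_right_lt.
  by rewrite -[LHS]/(g N.-1 s x) left_expand ?(ltW sT1)// xT (lt_trans sT1).
Unshelve. all: by end_near. Qed.

(** The difference of the two one-sided solutions has the derivatives of the impulse
response at t = s. *)
Let two_sided s j t : - T < s < T -> (j < N)%N -> I t ->
  shift_comb (fun i => g i T s) T j t =
  shift_comb (fun i => g i (- T) s) (- T) j t + \sum_(k < N) impulse_coef k s * e k j t.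
Proof.
move=> sT jN It; have Is := itI sT.
rewrite (impulse_expand)//.
pose D i x := shift_comb (fun i => g i T s) T i x + -1 * shift_comb (fun i =>
  g i (- T) s) (- T) i x.
have Ds i : (i < N)%N -> D i s = if i == N.-1 then inv_lead else 0.
  move=> iN; rewrite /D mulN1r; case: eqP => [->|/eqP iN1]; first exact: jump.
  by rewrite diag_right ?diag_left ?subrr//; lia.
have : D j t = shift_comb (D ^~ s) s j t.
  apply: (solve_expand (F := D)) => //.
    move=> i x iN Ix; apply: has_derivD; last apply: has_derivZ;
      apply: has_deriv_is_derive; exact: shift_comb_derive.
  move=> x Ix.
  rewrite -[LHS]/(poly_act S (jet_add (shift_comb (fun i => g i T s) T)
     (fun j x => -1 * shift_comb (fun i => g i (- T) s) (- T) j x)) 0 x).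
  rewrite poly_actDr /jet_add poly_act_shift_comb add0r /poly_act;
    under eq_bigr do rewrite mulrCA.
  by rewrite -mulr_sumr -[X in _ * X]/(poly_act S (shift_comb (fun i =>
    g i (- T) s) (- T)) 0 x)
     poly_act_shift_comb mulr0.
have -> : shift_comb (D ^~ s) s j t = inv_lead * e N.-1 j (t - s).
  have N1 : (N.-1 < N)%N by lia.
  rewrite /shift_comb (bigD1 (Ordinal N1))//= Ds// eqxx big1 ?addr0// => k kN.
  rewrite Ds// (_ : (k == N.-1 :> nat) = false) ?mul0r//.
  by apply/negbTE; apply: contraNneq kN => kN; apply/eqP/val_inj.
by rewrite /D mulN1r => <-; ring.
Qed.

Let xvec s : 'rV[R]_N := \row_k shift_comb (fun i => g i (- T) s) (- T) k 0.

Let green_rep s j t : - T < s < T -> (j < N)%N -> I t -> t <> s ->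
  g j t s = jet_add (fund_comb (xvec s)) (causal_jet s) j t.
Proof.
move=> sT jN It ts.
have leftE : shift_comb (fun i => g i (- T) s) (- T) j t = fund_comb (xvec s) j t.
  rewrite (solve_expand (F := shift_comb (fun i => g i (- T) s) (- T)) I0 It jN).
  - by apply: eq_bigr => k _; rewrite mxE subr0.
  - by move=> i x iN _; apply: has_deriv_is_derive; exact: shift_comb_derive.
  - by move=> x _; exact: poly_act_shift_comb.
have [tT tT'] : - T <= t /\ t <= T by move: It; rewrite /= in_itv/= => /andP.
rewrite /jet_add -leftE /causal_jet; have [st|] := ltP s t.
  rewrite right_expand// two_sided//; congr (_ + _); apply: eq_bigr => k _.
  by rewrite /causal_coef st.
rewrite le_eqVlt => /predU1P[//|st].
rewrite left_expand// big1 ?addr0// => k _.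
by rewrite /causal_coef ltNge (ltW st) mul0r.
Qed.

Let green_bc s c : - T < s < T ->
  reduced_form c (jet_add (fund_comb (xvec s)) (causal_jet s)) = 0.
Proof.
move=> sT; have Is := itI sT.
have [_ _ _ _ /(_ s sT) BC] := greenG.
have [sT1 sT2] : - T < s /\ s < T by apply/andP.
have Ts : T <> s by move=> E; move: sT2; rewrite E ltxx.
have NTs : - T <> s by move=> E; move: sT1; rewrite E ltxx.
have NTs' : T <> - s by move=> E; apply: NTs; rewrite E opprK.
have NTs2 : - T <> - s by move=> /oppr_inj.
case: c => i; have [B1 B2] := BC i; last first.
  rewrite -[RHS]B2; apply/esym/bform_jet_bform => j jn.
    by rewrite -green_rep//; lia.
  by rewrite -green_rep//; lia.
rewrite -[RHS]B1; apply/esym.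
(* The end points belong to J, so the boundary forms only see the smooth part. *)
pose J : set R := [set t | [/\ I t, t <> s & t <> - s]].
have oJ : relopen I J.
  split=> [t []//|t [It ts tNs]].
  near=> x => Ix; split=> //.
    by near: x; exact: near_neq.
  by near: x; exact: near_neq.
have sJ t : J t -> J (- t).
  move=> [It ts tNs]; split; first exact: sym_itv.
    by move=> E; apply: tNs; rewrite -E opprK.
  by move=> /oppr_inj.
have jG : jet_of I J (n + n) (G ^~ s) (fun j t => g j t s).
  by split=> // j jN t [It ts _]; apply: (green_nder Is).
have [_ jQ] := jet_apply_op (P := Q) T0 oJ sJ szp szq' jG.
have key j r : (j < n)%N -> r = T \/ r = - T ->
    derivn_in I j (apply_op I Q (G ^~ s)) r =
    op_act Q (jet_add (fund_comb (xvec s)) (causal_jet s)) j r.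
  move=> jn rE; rewrite jQ ?(ltnW jn)//; last first.
    by case: rE => ->; split.
  rewrite !(op_actE (P := Q) _ _ _ szp szq'); apply: eq_bigr => k _.
  have kj : (k + j < N)%N by have := ltn_ord k; lia.
  by case: rE => ->; rewrite ?opprK !green_rep.
by apply: bform_jet_bform => j jn; apply: key => //; [right|left].
Unshelve. all: by end_near. Qed.

(** The jump relation leaves one unknown solution of S u = 0, and the boundary
conditions are a linear system for its coefficients with matrix bc_matrix. *)
Lemma green_jets s j t : - T < s < T -> (j < N)%N -> I t -> t <> s ->
  derivn_in I j (G ^~ s) t = green_jet s j t.
Proof.
move=> sT jN It ts; rewrite -[LHS]/(g j t s) green_rep// /green_jet;
  congr (jet_add (fund_comb _) _ _ _).
have U := bc_matrix_unit.
rewrite /bc_correction; apply: (can_inj (mulmxK U)); rewrite mulNmx mulmxKV//.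
apply/rowP => c; rewrite !mxE.
(* The boundary conditions read x bc_matrix + (forms of the causal part) = 0. *)
have := green_bc (fintype.split c) sT.
rewrite (evalfun_add _ _ (evalfun_reduced_form _)).
by rewrite reduced_form_fund_comb => /eqP; rewrite addr_eq0 => /eqP <-; rewrite mxE.
Qed.

(** The operator evaluates G(., s) at t and at - t, which is why two values of s are
excluded. *)
Lemma green_op_first s t : - T < s < T -> I t -> t <> s -> t <> - s ->
  op_first T Q G t s = op_act Q (green_jet s) 0 t.
Proof.
move=> sT It ts tNs.
have Nts : - t <> s by move=> E; apply: tNs; rewrite -E opprK.
rewrite /op_first /apply_op /pullback /diffop /op_act /jet_add /jet_refl /poly_act mul1r.
congr (_ + _); apply: eq_bigr => k _; rewrite addn0 green_jets//.
- have := leq_trans (ltn_ord k) szp; lia.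
- exact: sym_itv.
- have := leq_trans (ltn_ord k) szq'; lia.
Qed.

End Green.

End ReducedProblem.

(** * Changing an integrand at finitely many points *)

Section FiniteModification.
Variable R : realType.
Notation mu := (@lebesgue_measure R).
Variables a b : R.
Notation I := `[a, b]%classic.

(** The values of g at the exceptional points are arbitrary, so even its
measurability has to be derived from that of f. *)
Lemma integrable_on_finite_mod (r : seq R) (f g : R -> R) : integrable_on a b f ->
  (forall s, I s -> s \notin r -> g s = f s) ->
  integrable_on a b g /\ itv_int a b g = itv_int a b f.
Proof.
move=> fi gf.
have cr : countable [set` r] by apply: finite_set_countable; exact: finite_seq.
have mr (A : set (measurableTypeR R)) : A `<=` [set` r] -> measurable A.
  move=> Ar; apply: countable_measurable => //.
  exact: sub_countable (subset_card_le Ar) cr.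
have mf := measurable_int _ fi.
have mg : measurable_fun I (EFin \o g).
  move=> mI Y mY.
  have -> : I `&` (EFin \o g) @^-1` Y =
     ((I `&` (EFin \o f) @^-1` Y) `\` [set` r]) `|` (I `&` (EFin \o g) @^-1` Y `&`
       [set` r]).
    apply/seteqP; split=> s /=.
      move=> [Is Ys]; have [sr|sr] := boolP (s \in r); first by right.
      by left; split; [rewrite -gf|exact/negP].
    by move=> [[[Is Ys] /negP sr]|[[Is Ys] _]]; split=> //; rewrite gf.
  apply: measurableU; last by apply: mr => s [].
  by apply: measurableD; [exact: mf|exact: mr].
have aefg : ae_eq mu I (EFin \o f) (EFin \o g).
  exists [set` r]; split; [exact: mr|exact: countable_lebesgue_measure0|].
  move=> s /= H; apply/negPn/negP => sr; apply: H => Is /=; by rewrite gf.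
split; last first.
  by rewrite /itv_int /Rintegral; congr fine; apply/esym/ae_eq_integral.
apply/integrableP; split=> //.
have /integrableP[_] := fi.
rewrite (_ : (\int[mu]_(x in I) `|(EFin \o f) x| = \int[mu]_(x in I) `|(EFin \o g) x|)%E)//.
apply: ae_eq_integral => //; [exact: measurableT_comp|exact: measurableT_comp|].
by apply: ae_imp aefg => s H Is; have /= := H Is => -[->].
Qed.

End FiniteModification.

(** * The integral formula *)

Section SmoothSolutions.
Variable R : realType.
Variable T : R.
Hypothesis T0 : 0 < T.
Notation I := `[- T, T]%classic.
Variables (n : nat) (L : reflop R) (alpha beta : 'M[R]_n).
Hypothesis szp : (size (refl_part L) <= n.+1)%N.
Hypothesis szq : (size (diff_part L) <= n.+1)%N.

(** Translates the uniqueness hypothesis from functions to jets. *)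
Lemma smooth_solves F : (forall j t, I t -> has_deriv I (F j) t (F j.+1 t)) ->
  (forall t, I t -> poly_act (reduced_poly L) F 0 t = 0) ->
    (forall c, reduced_form T L alpha beta c F = 0) ->
  solves_homogeneous (- T) T (reduced_poly L) (reduced_bc T (companion L) alpha beta) (F 0).
Proof.
move=> dF SF LF.
have szq' : (size (diff_part (companion L)) <= n.+1)%N
  by exact: leq_trans (size_poly _ _) szq.
have IT : I T by rewrite /= in_itv/= lexx ltW// oppT_lt.
have INT : I (- T) by rewrite /= in_itv/= lexx ltW// oppT_lt.
have jF m : jet_of I I m (F 0) F.
  by apply: jet_intro => //; [exact: oppT_lt|exact: relopen_refl|move=> *; exact: dF].
have [_ jQ] := jet_apply_op (P := companion L) T0 (relopen_refl I) (@sym_itv R T) szp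
  szq' (jF (n + n)%N).
split.
- by have [] := jF (size (reduced_poly L)).-1.
- move=> t It; rewrite -[RHS](SF t It); apply: eq_bigr => k _.
  by have [_ H] := jF k; rewrite addn0 H.
- move=> i; split.
    rewrite -[RHS](LF (inl i)); apply: bform_jet_bform => j jn; apply: jQ => //;
      exact: ltnW.
  rewrite -[RHS](LF (inr i)); have [_ H] := jF n.
  by apply: bform_jet_bform => j jn; apply: H => //; exact: ltnW.
Qed.

End SmoothSolutions.

Theorem theorem3p2 (R : realType) (T : R) (T_gt0 : 0 < T)
    (n : nat) (n_gt0 : (0 < n)%N) (L : reflop R) (alpha beta : 'M[R]_n) :
  exists (Q : reflop R) (S : {poly R}),
    [/\ Q = companion L,
        comp_is_diffop `[- T, T] Q L S &
        op_order L = n -> size S = (2 * n).+1 ->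
        (exists u, unique_solution_on `[- T, T]
           (solves_homogeneous (- T) T S (reduced_bc T Q alpha beta)) u) ->
        forall G : R -> R -> R,
        is_green (- T) T S (reduced_bc T Q alpha beta) G ->
        forall h : R -> R,
        (@lebesgue_measure R).-integrable `[- T, T] (EFin \o h) ->
        (forall t, `[- T, T]%classic t ->
           (@lebesgue_measure R).-integrable `[- T, T]
             (fun s => (op_first T Q G t s * h s)%:E)) /\
        unique_solution_on `[- T, T] (solves_problem T L alpha beta h)
          (fun t => \int[@lebesgue_measure R]_(s in `[- T, T])
                      (op_first T Q G t s * h s))].
Proof.
exists (companion L), (reduced_poly L); split=> //; first exact: comp_companion.
move=> ordL szS [u0 [_ uniq]] G greenG h ih.
have {}szS : size (reduced_poly L) = (n + n).+1 by rewrite szS mul2n addnn.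
have szp : (size (refl_part L) <= n.+1)%N.
  by rewrite -ordL /op_order;
    have := leq_maxl (size (refl_part L)) (size (diff_part L)); lia.
have szq : (size (diff_part L) <= n.+1)%N.
  by rewrite -ordL /op_order;
    have := leq_maxr (size (refl_part L)) (size (diff_part L)); lia.
have TT := oppT_lt T_gt0.
have hom F : (forall j t, `[- T, T]%classic t -> has_deriv `[- T, T] (F j) t (F j.+1 t)) ->
    (forall t, `[- T, T]%classic t -> poly_act (reduced_poly L) F 0 t = 0) ->
    (forall c, reduced_form T L alpha beta c F = 0) ->
    forall t, `[- T, T]%classic t -> F 0 t = 0.
  move=> dF SF LF t It.
  have H1 := uniq _ (smooth_solves T_gt0 szp szq dF SF LF) t It.
  have H2 : (fun=> 0) t = u0 t.
    apply: uniq It.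
    apply: (@smooth_solves _ _ T_gt0 _ _ _ _ szp szq (fun _ _ => 0)).
    - by move=> *; exact: has_deriv_cst.
    - by move=> x _; apply: big1 => k _; rewrite mulr0.
    - move=> c; have := evalfun_comb (@nil unit) (fun=> 0) (fun _ _ _ =>
      0) (evalfun_reduced_form T_gt0 L alpha beta c).
      by rewrite !big_nil.
  by rewrite H1 -H2.
have S1 : (1 < size (reduced_poly L))%N by rewrite szS; lia.
have [e fe] := fundsys_exists S1.
pose U := rsol T L alpha beta e h.
have sU : sobolev (- T) T n U by exact: sobolev_rsol.
have LU t : `[- T, T]%classic t -> op_act L U 0 t = h t by move=> It; exact: op_act_rsol.
have BU i : jet_bform T alpha beta i U = 0
  by exact: (jet_bform_rsol T_gt0 n_gt0 szp szq szS fe hom ih).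
have key t : `[- T, T]%classic t ->
    integrable_on (- T) T (fun s => op_first T (companion L) G t s * h s) /\
    itv_int (- T) T (fun s => op_first T (companion L) G t s * h s) = U 0 t.
  move=> It; rewrite /U.
  have [i1 ->] := rsol_int T_gt0 n_gt0 szp szq alpha beta szS fe ih It.
  (* The explicit form of G requires s interior and different from t and - t. *)
  apply: (integrable_on_finite_mod (r := [:: - T; T; t; - t]) i1) => s Is.
  rewrite !inE !negb_or => /and4P[s1 s2 s3 s4].
  have sT : - T < s < T.
    by move: Is; rewrite /= in_itv/= => /andP[h1 h2]; rewrite !lt_neqAle eq_sym s1 h1 s2 h2.
  rewrite (green_op_first T_gt0 n_gt0 szp szq szS fe hom greenG sT It)//.
    by move=> E; rewrite E eqxx in s3.
  by move=> E; rewrite E opprK eqxx in s4.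
split; first by move=> t It; have [H _] := key t It.
have uU t : `[- T, T]%classic t ->
    \int[@lebesgue_measure R]_(s in `[- T, T]) (op_first T (companion L) G t s * h s)
      = U 0 t.
  by move=> It; have [_ H] := key t It.
split.
  apply: (sobolev_solves T_gt0 n_gt0 szp szq sU uU) => //.
  by apply: ae_all => t; exact: LU.
move=> v Pv t It; rewrite uU//.
have [F [sF vF LF BF]] := solves_sobolev T_gt0 n_gt0 szp szq Pv.
rewrite vF//; apply/eqP; rewrite -subr_eq0; apply/eqP.
pose D := jet_add F (fun j t => -1 * U j t).
have lin Phi : evalfun (- T) T Phi -> Phi D = Phi F - Phi U.
  move=> eP; rewrite (evalfun_add _ _ eP); congr (_ + _).
  have := evalfun_comb [:: tt] (fun=> -1) (fun=> U) eP; rewrite big_seq1 mulN1r => <-.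
  by congr Phi; apply/funext => j; apply/funext => s; rewrite big_seq1.
have := kernel_uniq T_gt0 n_gt0 szp szq szS fe hom (F := D) _ _ _ n_gt0 It.
rewrite /D /jet_add mulN1r; apply.
- by apply: sobolevD => //; exact: sobolevZ.
- apply: ae_imp LF => s H Is; rewrite (lin _ (evalfun_op_act L 0 Is)).
  by rewrite H// LU// subrr.
- by move=> i; rewrite (lin _ (evalfun_jet_bform T_gt0 alpha beta i)) BF BU subrr.
Qed.
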